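(* There exists a transcendental entire function $f:\mathbb{C}\to\mathbb{C}$ of order exactly two, satisfying $|f(z)|\leq\sqrt{2}\,\exp(|z|^2)$ for all $z\in\mathbb{C}$ and such that for every nonempty open $U\subset\mathbb{C}$ there is an integer $N(U)$ with the property that $f^{(n)}$ has a zero in $U$ for every $n\geq N(U)$, and this function is a counterexample to the following assertion (the Boas--Reddy assertion): ''If $g$ is a transcendental entire function of order at most two and finite type, then there are arbitrarily large disks on each of which $g^{(k)}$ is zero-free for infinitely many values of $k$; that is, for every $\varrho>0$ there is an open disk $D\subset\mathbb{C}$ of radius at least $\varrho$ such that $g^{(k)}$ has no zero in $D$ for infinitely many $k\in\mathbb{N}$.'' That is, $g=f$ satisfies the hypotheses of this assertion but not its conclusion.
   Context: $\mathbb{N}=\{0,1,2,\ldots\}$, and $f^{(n)}$ denotes the $n$-th derivative of $f$ (with $f^{(0)}=f$). An entire function is transcendental if it is not a polynomial. For a nonconstant entire function $g$ put $M(r)=\max_{|z|=r}|g(z)|$. Its order is $\limsup_{r\to\infty}\frac{\log\log M(r)}{\log r}$. ''Order at most two and finite type'' is the growth class of entire functions with $\limsup_{r\to\infty}\frac{\log M(r)}{r^2}<\infty$. In the assertion, one fixed disk $D$ serves infinitely many $k$. *)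

(* Defs.v *)
From HB Require Import structures.
From mathcomp Require Import all_boot all_order all_algebra.
From mathcomp Require Import all_classical all_reals all_analysis.
From mathcomp Require Import complex.

Set Implicit Arguments.
Unset Strict Implicit.
Unset Printing Implicit Defensive.

Import Order.TTheory GRing.Theory Num.Theory.
Import numFieldNormedType.Exports.

Local Open Scope ring_scope.
Local Open Scope classical_set_scope.
Local Open Scope complex_scope.

(* The topology and the normed module structure over the field R[i] itself
   live on the regular module R[i]^o; derivability there is complex
   differentiability.  The library norm `|z| of R[i] takes values in R[i];
   normc is the same modulus, with values in R. *)
Notation Cplx R := (R[i]^o).
Notation cmod := ComplexField.Normc.normc.

Section entire_functions.
Context {R : realType}.
Implicit Types g : Cplx R -> Cplx R.

Definition entire g := forall z, derivable g z 1.

Definition transcendental_entire g :=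
  entire g /\ ~ exists p : {poly R[i]}, forall z, g z = p.[z].

(* For entire g and r >= 0 the set is nonempty and compact, so that its
   supremum is its maximum. *)
Definition max_modulus g (r : R) : R :=
  sup [set cmod (g z) | z in [set z | cmod z = r]].

(* ln x = 0 for x <= 0; this only affects values of r below some bound, since
   max_modulus g tends to infinity when g is nonconstant and entire. *)
Definition growth_order g : \bar R :=
  limf_esup (fun r : R => (ln (ln (max_modulus g r)) / ln r)%:E) +oo%R.

Definition order_le2_finite_type g : Prop :=
  (limf_esup (fun r : R => (ln (max_modulus g r) / r ^+ 2)%:E) +oo%R < +oo)%E.

Definition boas_reddy_hypotheses g :=
  transcendental_entire g /\ order_le2_finite_type g.

Definition boas_reddy_conclusion g :=
  forall rho : R, 0 < rho ->
    exists (c : Cplx R) (r : R), rho <= r /\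
      infinite_set [set k : nat |
        forall z : Cplx R, ball c r%:C z -> g^`(k) z <> 0].

End entire_functions.

(* Main.v *)
Require Import Defs.
From HB Require Import structures.
From mathcomp Require Import all_boot all_order all_algebra.
From mathcomp Require Import all_classical all_reals all_analysis.
From mathcomp Require Import complex.
From mathcomp Require Import ring lra zify.
Set Implicit Arguments.
Unset Strict Implicit.
Unset Printing Implicit Defensive.
Import Order.TTheory GRing.Theory Num.Theory.
Import numFieldNormedType.Exports.
Local Open Scope ring_scope.
Local Open Scope classical_set_scope.
Local Open Scope complex_scope.

(** The function is the lacunary part f(z) = sum_j z^(2 p_j) / p_j! of the
    exponential series of z^2, where p_0 = 0 and p_(j+1) = p_j + g(p_j) with a
    gap g(p) of order p^(1/3).

    The bound |f(z)| <= exp(|z|^2) holds term by term.  All coefficients being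
    nonnegative, f(r) is at least its term of index j, and at r^2 = e p_j this
    term is at least exp(p_j) = exp(r^2 / e).  So f has order two and finite
    type, and it is not a polynomial.

    The zeros come from the terms a_j z^(2 p_j - n) of the nth derivative.
    On |z| = x the largest terms are those with 2 p_j - n close to
    x sqrt(2 n).  In the full series, the moduli of consecutive terms have a
    quotient that decreases, at least by a factor 1 + 1/k at the exponent k of z
    ([coef_ratio_decay]).  In the lacunary series the quotient of consecutive
    terms accumulates about g of these factors in each of its g steps, so it
    drops by a factor exp(c g^2 / sqrt n) from one gap to the next.
    - Since g is much larger than n^(1/4), this drop is huge: at the radius rho
      where the terms j and j+1 have the same modulus, these two dominate the
      sum of all the others ([right_block_le], [left_block_le]), and near
      |z| = rho the derivative looks like a_j z^k (1 + b z^(2g)).  It has a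
      zero close to each of the 2g zeros of this binomial, which are equally
      spaced on the circle ([zero_near]).
    - Since g is much smaller than n^(1/2), a suitable j makes rho as close to
      any prescribed x as desired ([balanced_block_exists]).
    As n grows, both the radii and the arguments of these zeros become dense,
    so every open set contains zeros of all the derivatives of large order
    ([f_zeros]).  In particular no disk is free of zeros of infinitely many
    derivatives.

    Two tools replace general complex analysis.  Zeros of the partial sums,
    which are polynomials, are produced by [root_in_disk], where averaging over
    the roots of unity plays the part of the formula of Jensen; they
    accumulate at zeros of the derivative ([rapid_sum_zero]).  Series of
    monomials that converge geometrically on every disk are differentiated
    term by term through a second order Taylor estimate
    ([rapid_sum_derive1n]). *)

(** * Zeros of polynomials from values on a circle *)

Lemma prodB_unity_roots (C : closedFieldType) (M : nat) : (0 < M)%N ->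
  exists2 r : seq C, size r = M &
    (forall x, \prod_(w <- r) (x - w) = x ^+ M - 1) /\ {in r, forall w, w ^+ M = 1}.
Proof.
move=> M0; have [r Er] := closed_field_poly_normal ('X^M - 1 : {poly C}).
have mon : ('X^M - 1 : {poly C}) \is monic by rewrite monicXnsubC.
rewrite (monicP mon) scale1r in Er.
have Ex x : \prod_(w <- r) (x - w) = x ^+ M - 1.
  have := congr1 (horner^~ x) Er; rewrite !hornerE horner_prod => ->.
  by apply: eq_bigr => w _; rewrite !hornerE.
exists r.
  have := congr1 (fun p : {poly C} => size p) Er.
  by rewrite size_XnsubC // size_prod_XsubC => -[].
split=> // w wr; apply/eqP; rewrite -subr_eq0 -Ex.
by rewrite (big_rem w wr) /= subrr mul0r.
Qed.

Lemma prodB_circle (C : closedFieldType) (M : nat) (r : seq C) (s y : C) :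
  size r = M -> (forall x, \prod_(w <- r) (x - w) = x ^+ M - 1) -> s != 0 ->
  \prod_(w <- r) (y - s * w) = y ^+ M - s ^+ M.
Proof.
move=> rM Ex s0.
transitivity (\prod_(w <- r) (s * (y / s - w))).
  by apply: eq_bigr => w _; rewrite mulrBr mulrCA divff // mulr1.
rewrite big_split /= Ex big_const_seq count_predT rM iter_mulr_1.
by rewrite mulrBr mulr1 expr_div_n mulrCA divff ?mulr1 // expf_neq0.
Qed.

Lemma norm_unity (C : numClosedFieldType) (M : nat) (w : C) :
  (0 < M)%N -> w ^+ M = 1 -> `|w| = 1.
Proof.
move=> M0 wM; apply/eqP; rewrite -(@pexpr_eq1 _ _ M) // -normrX wM.
by rewrite normr1.
Qed.

(** A substitute for the theorem of Rouché.  Consider the product of |P| over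
    the points a + s w with w^M = 1.  If no root of P were at distance less than
    s from a, each root z would contribute |(z - a)^M - s^M| <= 2 |z - a|^M, so
    the product would be at most 2^d |P(a)|^M for d roots; but the bound on the
    circle makes it at least a constant times (2 B |a|^k)^M.  This is
    absurd for large M.  The weight |w|^k allows for the variation of a
    high power of w over the circle; its own product stays close to |a|^(k M)
    because 0 is far outside of the disk. *)
Lemma root_in_disk (C : numClosedFieldType) (P : {poly C}) (a s B : C) (k : nat) :
  0 < s -> 2 * s <= `|a| -> 0 < B ->
  `|P.[a]| <= B * `|a| ^+ k ->
  (forall w, `|w - a| = s -> 2 * B * `|w| ^+ k <= `|P.[w]|) ->
  exists2 z, root P z & `|z - a| < s.
Proof.
move=> s0 sa B0 Pa Pw.
have [zs EP] := closed_field_poly_normal P.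
case: (boolP (has (fun z => `|z - a| < s) zs)) => [/hasP[z zin za]|/hasPn far].
  exists z => //; rewrite EP rootE hornerZ horner_prod (big_rem z zin) /=.
  by rewrite hornerXsubC subrr mul0r mulr0.
exfalso.
have a0 : 0 < `|a| by apply: lt_le_trans sa; rewrite mulr_gt0.
(* M is chosen so that 2^M > 2^(d + k), against low and up below. *)
pose d := size zs; pose M := (d + k).+1.
have [r rM [rE r1]] := @prodB_unity_roots C M isT.
have sn0 : s != 0 by rewrite gt_eqF.
have dist y : \prod_(w <- r) `|a + s * w - y| = `|(y - a) ^+ M - s ^+ M|.
  rewrite -(@prodB_circle _ M r s (y - a)) // normr_prod.
  by apply: eq_bigr => w _; rewrite -normrN; congr `|_|; ring.
have up : \prod_(w <- r) `|P.[a + s * w]| <= 2 ^+ d * (B * `|a| ^+ k) ^+ M.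
  apply: (@le_trans _ _ (2 ^+ d * `|P.[a]| ^+ M)); last first.
    by rewrite ler_pM2l ?exprn_gt0 // lerXn2r // nnegrE // (le_trans _ Pa).
  rewrite EP.
  under eq_bigr => w _ do rewrite hornerZ horner_prod normrM normr_prod.
  rewrite big_split /= big_const_seq count_predT rM iter_mulr_1 exchange_big /=.
  rewrite hornerZ horner_prod normrM normr_prod exprMn -prodrXl mulrCA.
  rewrite ler_wpM2l ?exprn_ge0 // /d.
  rewrite -[in X in _ <= X * _](count_predT zs) -[X in X * _](iter_mulr_1).
  rewrite -big_const_seq -big_split /=.
  rewrite !big_seq; apply: ler_prod => z zin.
  have -> : \prod_(w <- r) `|('X - z%:P).[a + s * w]| = `|(z - a) ^+ M - s ^+ M|.
    by rewrite -dist; apply: eq_bigr => w _; rewrite !hornerE.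
  rewrite normr_ge0 /= !hornerE (distrC a z); apply: (le_trans (ler_normB _ _)).
  rewrite !normrX mulr2n mulrDl mul1r.
  rewrite lerD2l (gtr0_norm s0) lerXn2r // ?nnegrE ?(ltW s0) //.
  by have := far z zin; rewrite -real_leNgt ?realE ?normr_ge0 ?(ltW s0).
have low : (2 * B) ^+ M * (`|a| ^+ M / 2) ^+ k <= \prod_(w <- r) `|P.[a + s * w]|.
  apply: (@le_trans _ _ (\prod_(w <- r) (2 * B * `|a + s * w| ^+ k))).
    rewrite big_split /= big_const_seq count_predT rM iter_mulr_1 prodrXl.
    rewrite ler_wpM2l ?exprn_ge0 ?mulr_ge0 ?(ltW B0) //.
    rewrite lerXn2r ?nnegrE ?divr_ge0 ?exprn_ge0 ?prodr_ge0 //.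
    have := dist 0; under eq_bigr => w _ do rewrite subr0.
    move=> ->; rewrite sub0r exprNn.
    apply: le_trans (lerB_dist _ _).
    rewrite normrM normrX normrN1 expr1n mul1r !normrX (gtr0_norm s0).
    have : 2 * s ^+ M <= `|a| ^+ M.
      apply: (@le_trans _ _ ((2 * s) ^+ M)); last by rewrite lerXn2r ?nnegrE ?mulr_ge0 ?(ltW s0) ?(ltW a0).
      by rewrite exprMn ler_wpM2r ?exprn_ge0 ?(ltW s0) // exprS ler_peMr // exprn_ege1 // ler1n.
    move=> h; rewrite lerBrDr.
    have -> : `|a| ^+ M / 2 + s ^+ M = (`|a| ^+ M + 2 * s ^+ M) / 2 by field.
    by rewrite ler_pdivrMr // mulr2n mulrDr mulr1 lerD2l.
  rewrite !big_seq; apply: ler_prod => w wr.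
  rewrite mulr_ge0 ?exprn_ge0 ?mulr_ge0 ?(ltW B0) //=; apply: Pw.
  by rewrite addrAC subrr add0r normrM (gtr0_norm s0) (@norm_unity _ M w isT (r1 w wr)) ?mulr1.
have := le_trans low up.
have -> : (2 * B) ^+ M * (`|a| ^+ M / 2) ^+ k = 2 ^+ M / 2 ^+ k * (B * `|a| ^+ k) ^+ M.
  rewrite !exprMn exprVn -!exprM [(M * k)%N]mulnC; ring.
rewrite ler_pM2r ?exprn_gt0 ?mulr_gt0 ?exprn_gt0 // ler_pdivrMr ?exprn_gt0 //.
by rewrite -exprD ler_eXn2l ?ltr1n // ltnn.
Qed.

(** * Products of decaying factors *)

Section products.
Variable R : realFieldType.
Implicit Types (x : nat -> R) (a u K tau : R).

Lemma bernoulli_ineq a n : -1 <= a -> 1 + n%:R * a <= (1 + a) ^+ n.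
Proof.
move=> a1; elim: n => [|n IH]; first by rewrite mul0r addr0 expr0.
rewrite exprS -addn1 natrD.
apply: le_trans (ler_wpM2l _ IH); last by lra.
have : 0 <= n%:R * (a * a) by rewrite mulr_ge0 // -expr2 sqr_ge0.
lra.
Qed.

Lemma expr1D_le tau n : 0 <= tau -> n%:R * tau = 1 / 4 -> (1 + tau) ^+ n <= 4 / 3.
Proof.
move=> t0 nt.
case: n nt => [|n nt]; first by rewrite mul0r; lra.
have t1 : tau <= 1 / 4 by rewrite -nt ler_peMl // ler1n.
have b : 3 / 4 <= (1 - tau) ^+ n.+1.
  have := @bernoulli_ineq (- tau) n.+1 _; rewrite mulrN nt => h.
  by apply: le_trans (h _); lra.
have : (1 + tau) ^+ n.+1 * (1 - tau) ^+ n.+1 <= 1.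
  rewrite -exprMn exprn_ile1 //; first by rewrite mulr_ge0 //; lra.
  by have := sqr_ge0 tau; rewrite expr2; lra.
have : 0 <= (1 + tau) ^+ n.+1 by rewrite exprn_ge0 //; lra.
set A := (1 + tau) ^+ _; set B := (1 - tau) ^+ _ in b *.
move=> A0 AB; have : 0 <= A * (B - 3 / 4) by rewrite mulr_ge0 // subr_ge0.
lra.
Qed.

Lemma expr1B_inv_le tau n : 0 <= tau -> n%:R * tau = 1 / 4 ->
  ((1 - tau)^-1) ^+ n <= 4 / 3.
Proof.
move=> t0 nt.
case: n nt => [|n nt]; first by rewrite mul0r; lra.
have t1 : tau <= 1 / 4 by rewrite -nt ler_peMl // ler1n.
have b : 3 / 4 <= (1 - tau) ^+ n.+1.
  have := @bernoulli_ineq (- tau) n.+1 _; rewrite mulrN nt => h.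
  by apply: le_trans (h _); lra.
rewrite exprVn.
by rewrite (_ : 4 / 3 = (3 / 4)^-1) ?lef_pV2 ?posrE; lra.
Qed.

(** Each step gains a factor u = 1 / (1 + 1/K), so the product of N >= 2 H
    factors gains at least u^(H^2), which outweighs a^(2H) once H^2 is much
    larger than K.  The gain is capped at u^H because the decay of the quotients
    of consecutive terms is controlled on a bounded range only. *)
Lemma prod_decay_le x a K (H N : nat) :
  0 < K -> 200 * K <= H%:R ^+ 2 -> (2 * H <= N)%N ->
  1 <= a -> a ^+ (2 * H) <= 4 / 3 ->
  (forall t, (t < N)%N -> 0 <= x t /\ x t <= a * ((1 + K^-1)^-1) ^+ minn t H) ->
  \prod_(t < N) x t <= 1 / 100.
Proof.
move=> K0 HK HN a1 aH hx; set u := (1 + K^-1)^-1 in hx.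
have a0 : 0 <= a by lra.
have Ki : 0 < K^-1 by rewrite invr_gt0.
have u0 : 0 < u by rewrite invr_gt0; lra.
have u1 : u <= 1 by rewrite invf_le1 ?lerDl ?(ltW Ki) //; lra.
have H0 : (0 < H)%N by case: H HK {HN aH hx} => //; rewrite expr0n /=; lra.
have uH : u ^+ (H * H) <= 1 / 201.
  rewrite /u exprVn (_ : 1 / 201 = 201^-1); last by rewrite mul1r.
  rewrite lef_pV2 ?posrE ?exprn_gt0 //; last by lra.
  apply: le_trans (bernoulli_ineq _ _); last by lra.
  rewrite natrM -expr2.
  have : 200 <= H%:R ^+ 2 * K^-1 by rewrite ler_pdivlMr.
  lra.
have main : a ^+ (2 * H) * u ^+ (H * H) <= 1 / 100.
  apply: le_trans (ler_pM _ _ aH uH) _; rewrite ?exprn_ge0 ?(ltW u0) //; lra.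
(* The bound main also says that (a^2 u^H)^H <= 1. *)
have auH : a * u ^+ H <= 1.
  have : (a ^+ 2 * u ^+ H) ^+ H <= 1.
    by rewrite exprMn -!exprM; apply: le_trans main _; lra.
  rewrite expr_le1 ?mulr_ge0 ?exprn_ge0 ?(ltW u0) //.
  apply: le_trans; rewrite ler_wpM2r ?exprn_ge0 ?(ltW u0) //.
  by rewrite expr2 ler_peMl.
have HN' : (H <= N)%N by apply: leq_trans HN; rewrite mul2n -addnn leq_addl.
rewrite -(big_mkord xpredT x) (big_cat_nat (n := H)) //=.
apply: le_trans main.
have -> : a ^+ (2 * H) * u ^+ (H * H) = a ^+ H * (a * u ^+ H) ^+ H.
  by rewrite exprMn -exprM mulrA -exprD mul2n addnn.
have bnd (m n : nat) b : (n <= N)%N -> 0 <= b ->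
    (forall t, (m <= t < n)%N -> x t <= b) ->
    0 <= \prod_(m <= t < n) x t /\ \prod_(m <= t < n) x t <= b ^+ (n - m).
  move=> nN b0 xb; split.
    rewrite big_nat_cond; apply: prodr_ge0 => t; rewrite andbT => /andP[_ tn].
    by case: (hx t (leq_trans tn nN)).
  rewrite -prodr_const_nat big_nat_cond [in leRHS]big_nat_cond.
  apply: ler_prod => t; rewrite andbT => mtn.
  by rewrite xb // andbT; case: (hx t) => //; case/andP: mtn => _ /leq_trans; apply.
have [A0 A1] : 0 <= \prod_(0 <= t < H) x t /\ \prod_(0 <= t < H) x t <= a ^+ (H - 0).
  apply: bnd => // t /andP[_ tH].
  have [_ /le_trans] := hx t (leq_trans tH HN'); apply.
  by rewrite ler_piMr // exprn_ile1 // ltW.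
have [B0 B1] : 0 <= \prod_(H <= t < N) x t /\
    \prod_(H <= t < N) x t <= (a * u ^+ H) ^+ (N - H).
  apply: bnd => //; first by rewrite mulr_ge0 ?exprn_ge0 // ltW.
  move=> t /andP[Ht tN]; have [_ /le_trans] := hx t tN; apply.
  by rewrite (minn_idPr Ht).
rewrite subn0 in A1; apply: ler_pM => //; apply: le_trans B1 _.
rewrite ler_wiXn2l ?mulr_ge0 ?exprn_ge0 ?(ltW u0) //.
by rewrite leq_subRL // addnn -mul2n.
Qed.

(** Away from j and j.+1 the sequence decays at least geometrically in both
    directions.  The value 1/18 is chosen for the comparison in [zero_near]. *)
Lemma neighbours_sum_le (T : nat -> R) (j k : nat) : (forall i, 0 <= T i) ->
  (forall i, (i < j)%N -> T i <= T i.+1 / 100) ->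
  (forall i, (j < i)%N -> T i.+1 <= T i / 100) ->
  T j.+1 <= 4 / 3 * T j ->
  \sum_(0 <= i < j) T i + \sum_(j.+2 <= i < j.+2 + k) T i <= T j / 18.
Proof.
move=> T0 Tl Tr Tj.
have L i : (i <= j)%N -> \sum_(0 <= l < i) T l <= T i / 99.
  elim: i => [|i IH] ij; first by rewrite big_geq //; have := T0 0%N; lra.
  rewrite big_nat_recr //=; have := IH (ltnW ij); have := Tl i ij; lra.
have U l : \sum_(j.+2 <= i < j.+2 + l) T i + T (j.+1 + l)%N / 99 <= T j.+1 / 99.
  elim: l => [|l IH]; first by rewrite addn0 addn0 big_geq // add0r.
  rewrite addnS big_nat_recr ?leq_addr //=.
  have := Tr (j.+1 + l)%N; rewrite -[(j < _)%N]/(j.+1 <= _)%N leq_addr => /(_ isT).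
  rewrite addnS addSn -addSn; lra.
have := L j (leqnn j); have := U k; have := T0 (j.+1 + k)%N; have := T0 j; lra.
Qed.

End products.

(** * The sequence of half exponents *)

Section exponents.

(** The power of 2 of order p^(1/3); see [gap_cube_le] and [gap_cube_gt]. *)
Definition gap p := (2 ^ trunc_log 8 p)%N.

(** The exponents of the power series are the doubles of these numbers. *)
Fixpoint half_exp j := if j is i.+1 then (half_exp i + gap (half_exp i))%N else 0%N.

Lemma gap_gt0 p : (0 < gap p)%N. Proof. by rewrite expn_gt0. Qed.

Lemma leq_gap p q : (p <= q)%N -> (gap p <= gap q)%N.
Proof. by move=> pq; rewrite leq_exp2l // leq_trunc_log. Qed.

Lemma gap_cube p : (gap p ^ 3 = 8 ^ trunc_log 8 p)%N.
Proof. by rewrite /gap -expnM mulnC expnM. Qed.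

Lemma gap_cube_le p : (0 < p)%N -> (gap p ^ 3 <= p)%N.
Proof. by move=> p0; rewrite gap_cube trunc_logP. Qed.

Lemma gap_cube_gt p : (p < 8 * gap p ^ 3)%N.
Proof. by rewrite gap_cube -expnS trunc_log_ltn. Qed.

Lemma gap_large k p : (8 ^ k <= p)%N -> (k <= gap p)%N.
Proof.
move=> kp; have := @leq_trunc_log 8 _ _ kp; rewrite trunc_expnK // => h.
by apply: leq_trans h _; apply: ltnW; apply: ltn_expl.
Qed.

Lemma half_exp_ltS j : (half_exp j < half_exp j.+1)%N.
Proof. by rewrite /= -[ltnLHS]addn0 ltn_add2l gap_gt0. Qed.

Lemma leq_half_exp i j : (i <= j)%N -> (half_exp i <= half_exp j)%N.
Proof.
move=> ij; rewrite -(subnKC ij); elim: (j - i)%N => [|k IH]; first by rewrite addn0.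
by rewrite addnS; apply: leq_trans IH (ltnW (half_exp_ltS _)).
Qed.

Lemma half_exp_ge j : (j <= half_exp j)%N.
Proof. by elim: j => // j IH; apply: leq_ltn_trans IH (half_exp_ltS j). Qed.

Lemma half_exp_block p : exists j, (half_exp j <= p < half_exp j.+1)%N.
Proof.
elim: p => [|p [j /andP[jp pj]]]; first by exists 0%N; exact: (half_exp_ltS 0).
have [h|h] := ltnP p.+1 (half_exp j.+1).
  by exists j; rewrite (leq_trans jp).
by exists j.+1; rewrite h (leq_ltn_trans pj (half_exp_ltS _)).
Qed.

End exponents.

(** * Consecutive coefficients of a derivative of exp(z^2) *)

Section ratios.
Variable R : realFieldType.
Variable n : nat.

(** The coefficient of z^(2p - n) in the nth derivative of z^(2p) / p!. *)
Definition derivn_coef p : R := (p.*2 ^_ n)%:R / p`!%:R.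

(** The quotient of [derivn_coef] at m.+1 and at m, in closed form. *)
Definition coef_ratio m : R :=
  2 * (2 * m%:R + 1) / ((2 * m%:R + 2 - n%:R) * (2 * m%:R + 1 - n%:R)).

Lemma den_gt0 m : (n <= m.*2)%N -> 0 <= 2 * m%:R - n%:R :> R.
Proof. by move=> nm; rewrite subr_ge0 -natrM ler_nat mul2n. Qed.

Lemma coef_ratio_gt0 m : (n <= m.*2)%N -> 0 < coef_ratio m.
Proof.
move=> nm; have := den_gt0 nm; have : 0 <= m%:R :> R by [].
by move=> ? ?; rewrite /coef_ratio divr_gt0 // ?mulr_gt0 //; lra.
Qed.

Lemma derivn_coef_gt0 p : (n <= p.*2)%N -> 0 < derivn_coef p.
Proof. by move=> np; rewrite divr_gt0 // ltr0n ?ffact_gt0 // fact_gt0. Qed.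

Lemma derivn_coefS m : (n <= m.*2)%N -> derivn_coef m.+1 = coef_ratio m * derivn_coef m.
Proof.
move=> nm.
have E : ((m.+1.*2 ^_ n) * ((m.*2.+2 - n) * (m.*2.+1 - n)) = m.*2.+2 * m.*2.+1 * (m.*2 ^_ n))%N.
  have n2 : (n <= m.*2.+2)%N by rewrite (leq_trans nm) // ltnW.
  have := ffact_fact n2; have := ffact_fact nm.
  rewrite -doubleS; set A := (_ ^_ n)%N; set B := (_ ^_ n)%N => EA EB.
  have f0 : (0 < (m.*2 - n)`!)%N by rewrite fact_gt0.
  apply/eqP; rewrite -(eqn_pmul2r f0); apply/eqP.
  rewrite -[in RHS]mulnA EA -[in LHS]mulnA.
  have -> : ((m.*2.+2 - n) * (m.*2.+1 - n) * (m.*2 - n)`! = (m.+1.*2 - n)`!)%N.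
    by rewrite doubleS (subSn (leqW nm)) (subSn nm) !factS mulnA.
  by rewrite EB doubleS !factS mulnA.
have := congr1 (fun k => k%:R : R) E.
rewrite /= !natrM !natrB; [|lia|lia].
have M0 : 0 <= m%:R :> R by [].
have D := den_gt0 nm.
have d1 : 2 * m%:R + 2 - n%:R != 0 :> R by rewrite gt_eqF //; lra.
have d2 : 2 * m%:R + 1 - n%:R != 0 :> R by rewrite gt_eqF //; lra.
have f0 : m`!%:R != 0 :> R by rewrite pnatr_eq0 -lt0n fact_gt0.
have m1 : m%:R + 1 != 0 :> R by rewrite gt_eqF //; lra.
have -> : m.*2.+2%:R = 2 * m%:R + 2 :> R by rewrite -mul2n -addn2 natrD natrM.
have -> : m.*2.+1%:R = 2 * m%:R + 1 :> R by rewrite -mul2n -addn1 natrD natrM.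
rewrite /derivn_coef /coef_ratio factS natrM -[m.+1]addn1 natrD.
set A := (_ ^_ n)%:R; set B := (_ ^_ n)%:R => EE.
have -> : A = (2 * m%:R + 2) * (2 * m%:R + 1) * B /
   ((2 * m%:R + 2 - n%:R) * (2 * m%:R + 1 - n%:R)).
  by rewrite -EE; field; rewrite d1 d2.
by field; rewrite d1 d2 f0 m1.
Qed.

(** With k = 2m - n, the difference of the two sides has the sign of
    (k + 4)(k + n + 1) - (k + 1)(k + n + 3) = k + 3n + 1. *)
Lemma coef_ratio_decay m : (n <= m.*2)%N ->
  (1 + (2 * m%:R + 2 - n%:R)^-1) * coef_ratio m.+1 <= coef_ratio m.
Proof.
move=> nm; rewrite /coef_ratio -[m.+1]addn1 natrD.
have := den_gt0 nm; have : 0 <= n%:R :> R by [].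
set x : R := m%:R; set y : R := n%:R => y0.
have [k Ek] : exists k, k = 2 * x - y by exists (2 * x - y).
rewrite -Ek => k0.
have -> : x = (k + y) / 2 by rewrite Ek; field.
have e1 : 2 * ((k + y) / 2) = k + y by field.
have e2 : 2 * ((k + y) / 2 + 1) = k + y + 2 by field.
rewrite e1 e2.
rewrite -subr_ge0.
have -> : 2 * (k + y + 1) / ((k + y + 2 - y) * (k + y + 1 - y)) -
  (1 + (k + y + 2 - y)^-1) * (2 * (k + y + 2 + 1) / ((k + y + 2 + 2 - y) * (k + y + 2 + 1 - y)))
  = 2 * ((k + 4) * (k + y + 1) - (k + 1) * (k + y + 3)) / ((k + 2) * (k + 1) * (k + 4)).
  by field; repeat (apply/andP; split); rewrite gt_eqF //; lra.
rewrite divr_ge0 //.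
  have : 0 <= k * k by rewrite mulr_ge0.
  have : 0 <= k * y by rewrite mulr_ge0.
  lra.
by rewrite !mulr_ge0 //; lra.
Qed.

Lemma coef_ratio_decayn m t K : (n <= m.*2)%N -> 0 < K ->
  2 * (m + t)%:R <= n%:R + K ->
  (1 + K^-1) ^+ t * coef_ratio (m + t) <= coef_ratio m.
Proof.
move=> nm K0; elim: t => [|t IH] hK; first by rewrite expr0 mul1r addn0.
have nmt : (n <= (m + t).*2)%N by rewrite (leq_trans nm) // leq_double leq_addr.
have D := den_gt0 nmt.
rewrite addnS -[(m + t).+1]addn1 natrD in hK.
apply: le_trans (IH _); last by lra.
rewrite addnS exprSr -mulrA ler_wpM2l ?exprn_ge0 ?addr_ge0 ?invr_ge0 ?(ltW K0) //.
apply: le_trans (coef_ratio_decay nmt); rewrite ler_wpM2r //.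
  by apply/ltW/coef_ratio_gt0; rewrite (leq_trans nmt) // leq_double.
rewrite lerD2l lef_pV2 ?posrE //; lra.
Qed.

Lemma coef_ratio_le m t : (n <= m.*2)%N -> coef_ratio (m + t) <= coef_ratio m.
Proof.
move=> nm; have D := den_gt0 nm; pose K : R := 2 * (m + t)%:R + 1 - n%:R.
have K0 : 0 < K.
  have : m%:R <= (m + t)%:R :> R by rewrite ler_nat leq_addr.
  by rewrite /K; lra.
apply: le_trans (@coef_ratio_decayn m t K nm K0 _); last by rewrite /K; lra.
rewrite ler_peMl ?exprn_ege1 ?lerDl ?invr_ge0 ?(ltW K0) //.
by apply/ltW/coef_ratio_gt0; rewrite (leq_trans nm) // leq_double leq_addr.
Qed.

End ratios.

(** * Domination of all terms by two neighbours *)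

Lemma split_index (a b t m : nat) : (b <= a)%N -> (m <= t)%N ->
  (a + t = b + m + (a - b + (t - m)))%N.
Proof. lia. Qed.

Lemma rev_index_le (a t m : nat) : (t < a)%N -> (m <= t)%N -> (a - t.+1 + m <= a)%N.
Proof. lia. Qed.

Section dominance.
Variable R : realFieldType.

Lemma prod_eq1_ub (x : nat -> R) b N : (0 < N)%N -> 0 <= b ->
  (forall t, (t < N)%N -> 0 <= x t <= b) -> \prod_(t < N) x t = 1 -> 1 <= b.
Proof.
move=> N0 b0 xb x1; rewrite -(@expr_ge1 _ N) // -x1.
rewrite -[in leRHS](card_ord N) -prodr_const; apply: ler_prod => i _; exact: xb.
Qed.

Lemma prod_eq1_lb (x : nat -> R) b N : (0 < N)%N -> 0 <= b ->
  (forall t, (t < N)%N -> b <= x t) -> \prod_(t < N) x t = 1 -> b <= 1.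
Proof.
move=> N0 b0 xb x1; rewrite -(@expr_le1 _ N) // -x1.
by rewrite -[in leLHS](card_ord N) -prodr_const; apply: ler_prod => i _; rewrite b0 xb.
Qed.

(** At the radius rho the terms j and j.+1 of the nth derivative have the same
    modulus: their quotient is the product in the hypothesis named balanced.
    The radius r ranges over a relative neighbourhood of rho, of size tau. *)
Variables (n j H : nat) (K tau rho r : R).
Let g := gap (half_exp j).
Hypothesis nj : (n <= (half_exp j).*2)%N.
Hypothesis K0 : 0 < K.
Hypothesis HK : 200 * K <= H%:R ^+ 2.
Hypothesis gapH : forall i, (n <= (half_exp i).*2)%N -> (2 * H <= gap (half_exp i))%N.
Hypothesis rangeK : 2 * (half_exp j.+1 + H)%:R <= n%:R + K.
Hypothesis rho0 : 0 < rho.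
Hypothesis balanced : \prod_(t < g) (coef_ratio R n (half_exp j + t) * rho ^+ 2) = 1.
Hypothesis tau0 : 0 <= tau.
Hypothesis gtau : (2 * g)%:R * tau = 1 / 4.
Hypothesis rlo : rho * (1 - tau) <= r.
Hypothesis rhi : r <= rho * (1 + tau).

Let g0 : (0 < g)%N := gap_gt0 _.

Let nj1 : (n <= (half_exp j.+1).*2)%N.
Proof. by apply: leq_trans nj _; rewrite leq_double ltnW // half_exp_ltS. Qed.

Let tau1 : tau <= 1 / 4.
Proof. by rewrite -gtau ler_peMl // ler1n muln_gt0 /= g0. Qed.

Let r0 : 0 < r.
Proof. by apply: lt_le_trans rlo; rewrite mulr_gt0 // subr_gt0; apply: le_lt_trans tau1 _; lra. Qed.

Let s0 m : (half_exp j <= m)%N -> 0 < coef_ratio R n m.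
Proof. by move=> jm; apply: coef_ratio_gt0; apply: leq_trans nj _; rewrite leq_double. Qed.

Let rho20 : 0 < rho ^+ 2. Proof. by rewrite exprn_gt0. Qed.

Let first_ge1 : 1 <= coef_ratio R n (half_exp j) * rho ^+ 2.
Proof.
have pos : 0 <= coef_ratio R n (half_exp j) * rho ^+ 2 by rewrite mulr_ge0 // ltW // s0.
apply: (@prod_eq1_ub (fun t => coef_ratio R n (half_exp j + t) * rho ^+ 2) _ g g0 pos _ balanced) => t tg /=.
rewrite mulr_ge0 ?(ltW rho20) ?(ltW (s0 _)) ?leq_addr //=.
by rewrite ler_wpM2r ?(ltW rho20) // coef_ratio_le.
Qed.

Let next_le1 : coef_ratio R n (half_exp j.+1) * rho ^+ 2 <= 1.
Proof.
have pos : 0 <= coef_ratio R n (half_exp j.+1) * rho ^+ 2.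
  by rewrite mulr_ge0 ?(ltW rho20) // ltW // s0 // ltnW // half_exp_ltS.
apply: (@prod_eq1_lb (fun t => coef_ratio R n (half_exp j + t) * rho ^+ 2) _ g g0 pos _ balanced) => t tg /=.
rewrite ler_wpM2r ?(ltW rho20) // /=.
have -> : (half_exp j + gap (half_exp j) = half_exp j + t + (g - t))%N.
  by rewrite -addnA subnKC // ltnW.
by apply: coef_ratio_le; apply: leq_trans nj _; rewrite leq_double leq_addr.
Qed.

Let g2H : (2 * (2 * H) <= 2 * g)%N.
Proof. by rewrite leq_mul2l gapH. Qed.

(** To the right of the block j all quotients at the radius rho are at most 1
    and decay geometrically from the start; the passage from rho to r costs
    (1 + tau)^2 per factor, which [prod_decay_le] absorbs. *)
Lemma right_block_le i : (j < i)%N ->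
  \prod_(t < gap (half_exp i)) (coef_ratio R n (half_exp i + t) * r ^+ 2) <= 1 / 100.
Proof.
move=> ji.
have ni : (n <= (half_exp i).*2)%N.
  by apply: leq_trans nj1 _; rewrite leq_double leq_half_exp.
have ji1 : (half_exp j.+1 <= half_exp i)%N by apply: leq_half_exp.
apply: (@prod_decay_le _ (fun t => coef_ratio R n (half_exp i + t) * r ^+ 2) ((1 + tau) ^+ 2) K H) => //.
- exact: gapH.
- by rewrite exprn_ege1 // lerDl.
- rewrite -exprM; apply: le_trans (expr1D_le tau0 gtau).
  by rewrite ler_weXn2l // lerDl.
move=> t tg; set mt := minn t H.
have u0 : 0 < 1 + K^-1 by rewrite addr_gt0 // invr_gt0.
split; first by rewrite mulr_ge0 ?exprn_ge0 ?(ltW r0) // ltW // coef_ratio_gt0 // (leq_trans ni) // leq_double leq_addr.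
have r2 : r ^+ 2 <= (1 + tau) ^+ 2 * rho ^+ 2.
  rewrite -exprMn lerXn2r // ?nnegrE ?(ltW r0) //; last by rewrite mulrC.
  by rewrite mulr_ge0 ?(ltW rho0) // addr_ge0.
apply: (@le_trans _ _ (coef_ratio R n (half_exp i + t) * ((1 + tau) ^+ 2 * rho ^+ 2))).
  by rewrite ler_wpM2l // ltW // coef_ratio_gt0 // (leq_trans ni) // leq_double leq_addr.
rewrite mulrCA ler_wpM2l ?exprn_ge0 ?addr_ge0 // exprVn -[leRHS]mulr1 ler_pdivlMl ?exprn_gt0 //.
apply: le_trans next_le1; rewrite mulrA ler_wpM2r ?(ltW rho20) //.
have -> : (half_exp i + t = half_exp j.+1 + mt + (half_exp i - half_exp j.+1 + (t - mt)))%N.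
  by apply: split_index => //; exact: geq_minl.
apply: le_trans (@coef_ratio_decayn _ n (half_exp j.+1) mt K nj1 K0 _).
  rewrite ler_wpM2l ?exprn_ge0 ?(ltW u0) //; apply: coef_ratio_le.
  by apply: leq_trans nj1 _; rewrite leq_double leq_addr.
apply: le_trans rangeK; rewrite ler_wpM2l // ler_nat leq_add2l; exact: geq_minr.
Qed.

(** The mirror image of [right_block_le]: the factors are inverted and listed
    downwards from the end of the block. *)
Lemma left_block_le i : (i < j)%N -> (n <= (half_exp i).*2)%N ->
  \prod_(t < gap (half_exp i)) (coef_ratio R n (half_exp i + t) * r ^+ 2)^-1 <= 1 / 100.
Proof.
move=> ij ni.
have ij1 : (half_exp i.+1 <= half_exp j)%N by apply: leq_half_exp.
rewrite (reindex_inj rev_ord_inj) /=.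
have t10 : 0 < 1 - tau by rewrite subr_gt0; apply: le_lt_trans tau1 _; lra.
have i1 : 1 <= (1 - tau)^-1 by rewrite invf_ge1 // gerBl.
pose idx t := (half_exp i + (gap (half_exp i) - t.+1))%N.
apply: (@prod_decay_le _ (fun t => (coef_ratio R n (idx t) * r ^+ 2)^-1) (((1 - tau)^-1) ^+ 2) K H) => //.
- exact: gapH.
- by rewrite exprn_ege1 // i1.
- rewrite -exprM; apply: le_trans (expr1B_inv_le tau0 gtau).
  by rewrite ler_weXn2l // i1.
move=> t tg; set mt := minn t H.
have u0 : 0 < 1 + K^-1 by rewrite addr_gt0 // invr_gt0.
have nidx : (n <= (idx t).*2)%N by apply: leq_trans ni _; rewrite leq_double leq_addr.
have sidx := coef_ratio_gt0 R nidx.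
split; first by rewrite invr_ge0 mulr_ge0 ?exprn_ge0 ?(ltW r0) // ltW.
rewrite !exprVn -invfM lef_pV2 ?posrE ?(mulr_gt0 sidx (exprn_gt0 _ r0)) //; last first.
  by rewrite mulr_gt0 // exprn_gt0.
have r2 : (1 - tau) ^+ 2 * rho ^+ 2 <= r ^+ 2.
  rewrite -exprMn lerXn2r // ?nnegrE ?(ltW r0) //; last by rewrite mulrC.
  by rewrite mulr_ge0 ?(ltW rho0) // ltW.
apply: (@le_trans _ _ (coef_ratio R n (idx t) * ((1 - tau) ^+ 2 * rho ^+ 2))); last first.
  by rewrite ler_wpM2l // ltW.
rewrite [leRHS]mulrCA ler_wpM2l ?exprn_ge0 ?(ltW t10) //.
have jE : (half_exp j = idx t + mt + (half_exp j - (idx t + mt)))%N.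
  rewrite subnKC // (leq_trans _ ij1) //= /idx -addnA leq_add2l.
  by apply: rev_index_le => //; exact: geq_minl.
have : (1 + K^-1) ^+ mt * coef_ratio R n (idx t + mt) <= coef_ratio R n (idx t).
  apply: coef_ratio_decayn => //; apply: le_trans rangeK.
  rewrite ler_wpM2l // ler_nat.
  by apply: (@leq_trans (half_exp j)); [rewrite jE leq_addr | apply: leq_trans (ltnW (half_exp_ltS j)) (leq_addr _ _)].
have h1 : 1 <= coef_ratio R n (idx t + mt) * rho ^+ 2.
  apply: le_trans first_ge1 _; rewrite ler_wpM2r ?(ltW rho20) // jE.
  by apply: coef_ratio_le; apply: leq_trans nidx _; rewrite leq_double leq_addr.
move=> h2; apply: (@le_trans _ _ ((1 + K^-1) ^+ mt * coef_ratio R n (idx t + mt) * rho ^+ 2)).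
  by rewrite -mulrA ler_peMr // exprn_ge0 // ltW.
by rewrite ler_wpM2r ?(ltW rho20).
Qed.

Lemma mid_block_le :
  \prod_(t < g) (coef_ratio R n (half_exp j + t) * r ^+ 2) <= 4 / 3.
Proof.
apply: (@le_trans _ _ (\prod_(t < g) ((coef_ratio R n (half_exp j + t) * rho ^+ 2) * (1 + tau) ^+ 2))).
  apply: ler_prod => t _.
  have st := s0 (leq_addr t (half_exp j)).
  rewrite mulr_ge0 ?exprn_ge0 ?(ltW r0) ?(ltW st) //= -mulrA ler_wpM2l ?(ltW st) //.
  rewrite -exprMn lerXn2r // ?nnegrE ?(ltW r0) //.
  by rewrite mulr_ge0 ?(ltW rho0) // addr_ge0.
rewrite big_split /= balanced mul1r prodr_const card_ord -exprM.
exact: expr1D_le.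
Qed.

End dominance.

(** * A block of exponents balanced at a prescribed radius *)

Section asymptotics.

(** Here y stands for x sqrt(2n).  If 2m - n is close to y, and y is small
    compared to n, then the ratio is close to 2n / y^2 = 1 / x^2. *)
Lemma coef_ratio_near (R : realFieldType) (n m : nat) (x y E e : R) :
  0 < y -> y ^+ 2 = 2 * n%:R * x ^+ 2 -> 0 <= E -> 0 < e -> e <= 1 / 8 ->
  E <= e * y -> y + E <= e * n%:R ->
  y - E <= 2 * m%:R + 1 - n%:R -> 2 * m%:R + 2 - n%:R <= y + E ->
  1 - 8 * e <= coef_ratio R n m * x ^+ 2 <= 1 + 8 * e.
Proof.
move=> y0 yy E0 e0 e8 Ey yn lo hi.
set N : R := n%:R in yy yn lo hi *; set M : R := m%:R in lo hi *.
have N0 : 0 < N by rewrite -(pmulr_rgt0 _ e0); lra.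
have ey8 : e * y <= y / 8.
  have : 0 <= (1 / 8 - e) * y by rewrite mulr_ge0 //; lra.
  lra.
rewrite /coef_ratio -/N -/M.
have [a Ea] : exists a, a = 2 * M + 1 - N by exists (2 * M + 1 - N).
have -> : 2 * M + 1 = N + a by rewrite Ea; ring.
have -> : 2 * M + 2 - N = a + 1 by rewrite Ea; ring.
have -> : N + a - N = a by ring.
have lo' : y - E <= a by rewrite Ea.
have hi' : a + 1 <= y + E by rewrite Ea; lra.
have a0 : 0 < a by lra.
have ab0 : 0 < (a + 1) * a by rewrite mulr_gt0 //; lra.
have -> : 2 * (N + a) / ((a + 1) * a) * x ^+ 2 = y ^+ 2 * (1 + a / N) / ((a + 1) * a).
  by rewrite yy; field; rewrite !gt_eqF //; lra.
have aN : 0 <= a / N <= e.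
  by rewrite divr_ge0 ?(ltW a0) ?(ltW N0) //= ler_pdivrMr //; lra.
move: aN; set c := a / N => /andP[c0 ce].
have y20 : 0 < y ^+ 2 by rewrite exprn_gt0.
have L : (1 - e) ^+ 2 * y ^+ 2 <= (a + 1) * a.
  rewrite -exprMn expr2; apply: ler_pM; rewrite ?mulr_ge0 //; lra.
have U : (a + 1) * a <= (1 + e) ^+ 2 * y ^+ 2.
  rewrite -exprMn expr2; apply: ler_pM; rewrite ?mulr_ge0 //; lra.
have ee : 0 <= e * (1 / 8 - e) by rewrite mulr_ge0 //; lra.
have e2 : 0 <= e * e by rewrite mulr_ge0 // ltW.
have e3 : 0 <= e * (e * e) by rewrite mulr_ge0 // ltW.
apply/andP; split.
  rewrite ler_pdivlMr //.
  apply: (@le_trans _ _ ((1 - 8 * e) * ((1 + e) ^+ 2 * y ^+ 2))).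
    by rewrite ler_wpM2l //; lra.
  rewrite mulrA [leRHS]mulrC ler_wpM2r ?(ltW y20) //.
  rewrite expr2; lra.
rewrite ler_pdivrMr //.
apply: (@le_trans _ _ ((1 + 8 * e) * ((1 - e) ^+ 2 * y ^+ 2))); last first.
  by rewrite ler_wpM2l //; lra.
rewrite mulrA [leLHS]mulrC ler_wpM2r ?(ltW y20) //.
rewrite expr2; lra.
Qed.

Lemma gap_uphalf_range n : (0 < n)%N ->
  (gap (uphalf n) ^ 3 <= n)%N /\ (n < 16 * gap (uphalf n) ^ 3)%N.
Proof.
move=> n0; have h0 : (0 < uphalf n)%N by case: n n0.
have hn : (uphalf n <= n)%N by rewrite leq_uphalf_double -addnn leq_addr.
have h2 : (n <= 2 * uphalf n)%N by rewrite mul2n -leq_uphalf_double.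
split; first exact: leq_trans (gap_cube_le h0) hn.
apply: leq_ltn_trans h2 _; rewrite -[16%N]/(2 * 8)%N -mulnA ltn_pmul2l //.
exact: gap_cube_gt.
Qed.

(** Both sides are powers of 2, and n < 16 g^3 < 8^2 g^3 for the gap g at
    the half of n. *)
Lemma gap_le_double p n : (p <= n)%N -> (0 < n)%N -> (gap p <= 2 * gap (uphalf n))%N.
Proof.
move=> pn n0; rewrite {2}/gap -expnS leq_exp2l //.
case: p pn => [|p] pn; first by rewrite trunc_log0.
rewrite -ltnS -(@ltn_exp2l 8) //.
apply: leq_ltn_trans (@trunc_logP 8 p.+1 isT isT) _.
apply: leq_ltn_trans pn _.
have [_] := gap_uphalf_range n0; rewrite gap_cube => /leq_trans; apply.
by rewrite !expnS mulnA leq_mul2r; apply/orP; right.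
Qed.

End asymptotics.

Section block_choice.

Lemma half_lt_add (m a b c : nat) : (m./2 < a + b)%N -> (b <= 2 * c)%N ->
  (m + 1 <= 2 * a + 4 * c)%N.
Proof. lia. Qed.

Lemma half_ge_add (m a b c : nat) : (a <= m./2)%N -> (b <= 2 * c)%N ->
  (2 * (a + b) <= m + 4 * c)%N.
Proof. lia. Qed.

Lemma natr_le_lo (R : realFieldType) (n q a G : nat) :
  (n + q + 1 <= 2 * a + 4 * G)%N -> n%:R + q%:R + 1 <= 2 * a%:R + 4 * G%:R :> R.
Proof. by rewrite -(ler_nat R) => h; lra. Qed.

Lemma natr_le_hi (R : realFieldType) (n q a G : nat) :
  (2 * a <= n + q + 4 * G)%N -> 2 * a%:R <= n%:R + q%:R + 4 * G%:R :> R.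
Proof. by rewrite -(ler_nat R) => h; lra. Qed.

Lemma le_of_sqr_le (R : realDomainType) (a b : R) :
  0 <= a -> 0 <= b -> a ^+ 2 <= b ^+ 2 -> a <= b.
Proof. by move=> a0 b0; rewrite ler_pXn2r // nnegrE. Qed.

Section scales.
Variables (R : realFieldType) (x e g y N : R).
Hypotheses (x0 : 0 < x) (e0 : 0 < e) (g0 : 0 < g) (y0 : 0 < y).
Hypothesis yy : y ^+ 2 = 2 * N * x ^+ 2.

Let x20 : 0 < x ^+ 2. Proof. by rewrite exprn_gt0. Qed.
Let e20 : 0 < e ^+ 2. Proof. by rewrite exprn_gt0. Qed.

(** In this section N is the order n of the derivative, g a gap of order
    N^(1/3), and y = x sqrt(2N).  The three lemmas quantify that g is much
    smaller than y, that y is much smaller than N, and that y is much smaller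
    than g^2. *)
Lemma gap_le_scale : g ^+ 3 <= N -> 13 / (e ^+ 2 * x ^+ 2) <= g -> 5 * g <= e * y.
Proof.
move=> gN; rewrite ler_pdivrMr ?mulr_gt0 // => h.
apply: le_of_sqr_le; rewrite ?mulr_ge0 ?(ltW g0) ?(ltW e0) ?(ltW y0) //.
rewrite !exprMn yy.
apply: (@le_trans _ _ (2 * (g * (e ^+ 2 * x ^+ 2)) * g ^+ 2)).
  by rewrite ler_wpM2r ?exprn_ge0 ?(ltW g0) //; lra.
have -> : 2 * (g * (e ^+ 2 * x ^+ 2)) * g ^+ 2 = 2 * (e ^+ 2 * x ^+ 2) * g ^+ 3 by ring.
have -> : e ^+ 2 * (2 * N * x ^+ 2) = 2 * (e ^+ 2 * x ^+ 2) * N by ring.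
by rewrite ler_wpM2l // !mulr_ge0 // ltW.
Qed.

Lemma scale_le_order : 0 < N -> 8 * x ^+ 2 / e ^+ 2 <= N -> 2 * y <= e * N.
Proof.
move=> N0; rewrite ler_pdivrMr // => h.
apply: le_of_sqr_le; rewrite ?mulr_ge0 ?(ltW e0) ?(ltW y0) ?(ltW N0) //.
rewrite !exprMn yy.
have -> : 2 ^+ 2 * (2 * N * x ^+ 2) = N * (8 * x ^+ 2) by ring.
have -> : e ^+ 2 * N ^+ 2 = N * (N * e ^+ 2) by ring.
by rewrite ler_wpM2l ?(ltW N0).
Qed.

Lemma scale_le_gap_sqr (C : R) : 0 <= C -> N <= 16 * g ^+ 3 ->
  C ^+ 2 * 32 * x ^+ 2 <= g -> C * y <= g ^+ 2.
Proof.
move=> C0 Ng h; apply: le_of_sqr_le.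
- by rewrite mulr_ge0 ?(ltW y0).
- by rewrite exprn_ge0 ?(ltW g0).
rewrite exprMn yy; apply: (@le_trans _ _ (C ^+ 2 * 32 * x ^+ 2 * g ^+ 3)).
  have -> : C ^+ 2 * (2 * N * x ^+ 2) = (C ^+ 2 * 2 * x ^+ 2) * N by ring.
  have -> : C ^+ 2 * 32 * x ^+ 2 * g ^+ 3 = (C ^+ 2 * 2 * x ^+ 2) * (16 * g ^+ 3).
    by ring.
  by rewrite ler_wpM2l // mulr_ge0 ?(ltW x20) // mulr_ge0 // exprn_ge0.
by rewrite -exprM [leRHS]exprS ler_wpM2r ?exprn_ge0 ?(ltW g0).
Qed.

End scales.

(** The block j is the one that contains (n + q) / 2, where q is the integer
    part of y = x sqrt(2n): the quotient of consecutive terms at the radius x is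
    close to 1 when 2p - n is close to y.  The number 2 H is the gap at the half
    of n, which bounds from below all the gaps met by exponents at least n, and
    K = 2 y bounds 2m - n on the range where the decay of the quotients is
    used. *)
Lemma balanced_block_exists (R : realType) (x e : R) (N0 : nat) :
  0 < x -> 0 < e -> e <= 1 / 8 -> exists n0, forall n, (n0 <= n)%N ->
  exists (j H : nat) (K : R),
    [/\ (n <= (half_exp j).*2)%N, 0 < K, 200 * K <= H%:R ^+ 2,
        forall i, (n <= (half_exp i).*2)%N -> (2 * H <= gap (half_exp i))%N &
        2 * (half_exp j.+1 + H)%:R <= n%:R + K] /\
    (N0 <= gap (half_exp j))%N /\
    forall t, (t < gap (half_exp j))%N ->
      1 - 8 * e <= coef_ratio R n (half_exp j + t) * x ^+ 2 <= 1 + 8 * e.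
Proof.
move=> x0 e0 e8.
(* A1, A2 and A3 are the thresholds of the three comparisons of scales; the
   bound G0 on n makes the gap G exceed all of them. *)
pose A1 := 13 / (e ^+ 2 * x ^+ 2); pose A2 := 8 * x ^+ 2 / e ^+ 2.
have [C C0 CE] : exists2 C : R, 0 <= C & C = 40 ^+ 2.
  by exists (40 ^+ 2) => //; rewrite exprn_ge0.
pose A3 := C ^+ 2 * 32 * x ^+ 2.
have x20 : 0 < x ^+ 2 by rewrite exprn_gt0.
have e20 : 0 < e ^+ 2 by rewrite exprn_gt0.
have A10 : 0 <= A1 by rewrite divr_ge0 ?mulr_ge0 // ltW.
have A20 : 0 <= A2 by rewrite divr_ge0 ?mulr_ge0 // ltW.
have A30 : 0 <= A3 by rewrite mulr_ge0 ?(ltW x20) // mulr_ge0 // exprn_ge0.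
pose G0 := (Num.truncn (A1 + A2 + A3 + N0%:R)).+3.
have G0A : A1 + A2 + A3 + N0%:R <= G0%:R.
  by apply: le_trans (ltW (truncnS_gt _)) _; rewrite ler_nat; exact: leqW (leqW (leqnn _)).
exists (2 * 8 ^ G0)%N => n hn.
have n0 : (0 < n)%N by apply: leq_trans hn; rewrite muln_gt0 expn_gt0.
have hG : (8 ^ G0 <= uphalf n)%N.
  rewrite -(leq_pmul2l (m := 2)) //; apply: leq_trans hn _.
  by rewrite mul2n -leq_uphalf_double.
have GG0 := gap_large hG; set G := gap _ in GG0.
pose L := trunc_log 8 (uphalf n).
have L0 : (0 < L)%N.
  by have := @leq_trunc_log 8 _ _ hG; rewrite trunc_expnK // => /(leq_trans _); apply.
pose H := (2 ^ L.-1)%N.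
have GH : G = (2 * H)%N by rewrite /H -expnS prednK.
have [nlo nhi] := gap_uphalf_range n0.
have NN0 : 0 <= N0%:R :> R by [].
have gA : A1 + A2 + A3 + N0%:R <= G%:R by apply: le_trans G0A _; rewrite ler_nat.
have [g1 g2] : A1 <= G%:R /\ A2 <= G%:R by split; lra.
have [g3 gN0] : A3 <= G%:R /\ N0%:R <= G%:R :> R by split; lra.
have G3 : (3 <= G)%N by apply: leq_trans GG0.
have g0 : 0 < G%:R :> R by rewrite ltr0n (leq_trans _ G3).
have nlo' : G%:R ^+ 3 <= n%:R :> R by rewrite -natrX ler_nat.
have nhi' : n%:R <= 16 * G%:R ^+ 3 :> R by rewrite -natrX -natrM ler_nat ltnW.
have nr0 : 0 < n%:R :> R by rewrite ltr0n.
have gn : G%:R <= n%:R :> R.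
  by apply: le_trans nlo'; rewrite -natrX ler_nat -{1}(expn1 G) leq_exp2l // (leq_trans _ G3).
have [y y0 yy] : exists2 y : R, 0 < y & y ^+ 2 = 2 * n%:R * x ^+ 2.
  exists (x * Num.sqrt (2 * n%:R)).
    by rewrite mulr_gt0 // sqrtr_gt0 mulr_gt0.
  by rewrite exprMn sqr_sqrtr ?mulr_ge0 // mulrC.
have c1 := gap_le_scale x0 e0 g0 y0 yy nlo' g1.
have c2 := scale_le_order e0 y0 yy nr0 (le_trans g2 gn).
have c3 := scale_le_gap_sqr x0 g0 y0 yy C0 nhi' g3; rewrite CE in c3.
have g3r : 3 <= G%:R :> R by rewrite ler_nat.
have ey8 : e * y <= 1 / 8 * y by rewrite ler_wpM2r // ltW.
have en8 : e * n%:R <= 1 / 8 * n%:R by rewrite ler_wpM2r.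
clearbody A1 A2 A3; clear gA g1 g2 g3 nlo' nhi' A10 A20 A30 x20 e20 G0A gn.
have yn : y <= n%:R by clear -y0 nr0 c2 en8; lra.
pose q := Num.truncn y.
have [qlo qhi] : q%:R <= y /\ y < q%:R + 1.
  have := truncn_itv (ltW y0); rewrite -/q => /andP[-> h]; split => //.
  by rewrite -[1]/(1%:R) -natrD addn1.
have qn : (q <= n)%N by rewrite -(ler_nat R); apply: le_trans qlo yn.
have [j /andP[jp pj]] := half_exp_block (n + q)./2.
have pjn : (half_exp j <= n)%N.
  by apply: leq_trans jp _; rewrite leq_half_double -addnn leqW // leq_add2l.
have gj := gap_le_double pjn n0; rewrite -/G in gj.
have GH' i : (n <= (half_exp i).*2)%N -> (2 * H <= gap (half_exp i))%N.
  by move=> ni; rewrite -GH; apply: leq_gap; rewrite leq_uphalf_double.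
(* Every p in the block satisfies |2p - (n + q)| <= 4 G. *)
exists j, H, (2 * y).
have plr : n%:R + q%:R + 1 <= 2 * (half_exp j)%:R + 4 * G%:R :> R.
  by apply: natr_le_lo; exact: half_lt_add pj gj.
have phr : 2 * (half_exp j + gap (half_exp j))%:R <= n%:R + q%:R + 4 * G%:R :> R.
  by apply: natr_le_hi; exact: half_ge_add jp gj.
have nj : (n <= (half_exp j).*2)%N.
  rewrite -mul2n -(ler_nat R) natrM.
  by clear -plr qhi c1 ey8 y0 g3r; lra.
have HR : G%:R = 2 * H%:R :> R by rewrite GH natrM.
split.
  split=> //; first by rewrite mulr_gt0.
    have : 4 * H%:R ^+ 2 = G%:R ^+ 2 :> R by rewrite HR; ring.
    by clear -c3; lra.
  rewrite natrD /=.
  by clear -phr qlo HR c1 ey8 y0 g3r; lra.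
split=> [|t tg].
  by apply: leq_trans (GH' j nj); rewrite -GH -(ler_nat R).
have G5 : 0 <= 5 * G%:R :> R by rewrite mulr_ge0.
apply: (@coef_ratio_near _ _ _ _ y (5 * G%:R)) => //.
- by clear -c1 c2 ey8 y0; lra.
- rewrite natrD; have : 0 <= t%:R :> R by [].
  by clear -plr qhi g3r; lra.
have : (half_exp j + t)%:R + 1 <= (half_exp j + gap (half_exp j))%:R :> R.
  by rewrite -[1]/(1%:R) -natrD ler_nat addn1 ltn_add2l.
by clear -phr qlo g3r; lra.
Qed.

End block_choice.

(** * The complex modulus and limits with geometric error *)

Section modulus.
Variable R : rcfType.
Implicit Types z w : R[i].

Lemma normE z : `|z| = (cmod z)%:C. Proof. by []. Qed.

Lemma cmod_ge0 z : 0 <= cmod z.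
Proof. by rewrite -lecR -normE normr_ge0. Qed.

Lemma cmodM z w : cmod (z * w) = cmod z * cmod w.
Proof. exact: ComplexField.Normc.normcM. Qed.

Lemma cmodX z n : cmod (z ^+ n) = cmod z ^+ n.
Proof. by apply/complexI; rewrite rmorphXn /= -!normE normrX. Qed.

Lemma cmodB z w : cmod (z - w) = cmod (w - z).
Proof. by apply/complexI; rewrite -!normE distrC. Qed.

Lemma cmodR (x : R) : 0 <= x -> cmod x%:C = x.
Proof. by move=> x0; rewrite /= expr0n addr0 sqrtr_sqr ger0_norm. Qed.

Lemma cmod_sum (I : Type) (r : seq I) (P : pred I) (F : I -> R[i]) :
  cmod (\sum_(i <- r | P i) F i) <= \sum_(i <- r | P i) cmod (F i).
Proof.
rewrite -lecR -normE rmorph_sum; apply: le_trans (ler_norm_sum _ _ _) _.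
exact: lexx.
Qed.

Lemma cmod_le_sub z w : cmod z - cmod w <= cmod (z - w).
Proof. by rewrite lerBlDr; have := le_normcD (z - w) w; rewrite subrK. Qed.

Lemma Re_le_cmod z : `|complex.Re z| <= cmod z.
Proof. by rewrite -lecR -normE normc_ge_Re. Qed.

Lemma Im_le_cmod z : `|complex.Im z| <= cmod z.
Proof.
case: z => x y /=; rewrite -(@sqrtr_sqr _ y) ler_sqrt ?addr_ge0 ?sqr_ge0 //.
by rewrite lerDr sqr_ge0.
Qed.

Lemma cmod_le_ReIm z : cmod z <= `|complex.Re z| + `|complex.Im z|.
Proof.
case: z => x y /=; rewrite -(@ger0_norm _ (`|x| + `|y|)) ?addr_ge0 // -(@sqrtr_sqr _ (`|x| + `|y|)).
rewrite ler_sqrt ?sqr_ge0 // sqrrD !real_normK ?num_real // addrAC lerDl.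
by rewrite mulrn_wge0 // mulr_ge0.
Qed.

End modulus.

Section real_limits.
Variable R : realType.
Implicit Types (u : nat -> R) (a b K : R).

(** Passages to the limit along partial sums go through this lemma, with
    explicit geometric errors. *)
Lemma le_of_geometric_error a b K :
  (forall n, a <= b + K / 2 ^+ n) -> a <= b.
Proof.
move=> h; rewrite leNgt; apply/negP => ba.
have ab0 : 0 < a - b by rewrite subr_gt0.
have K0 : 0 < K by have := h 0%N; rewrite expr0 divr1; lra.
pose n := (Num.truncn (K / (a - b))).+1; have := h n.
have Kn : K / (a - b) < 2 ^+ n.
  apply: lt_le_trans (truncnS_gt _) _.
  by rewrite -natrX ler_nat ltnW // ltn_expl.
rewrite ltr_pdivrMr // in Kn.
have : K / 2 ^+ n < a - b by rewrite ltr_pdivrMr ?exprn_gt0 // mulrC.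
lra.
Qed.

Lemma sum_geometric_le u K m N : (forall i, u i <= K / 2 ^+ i) ->
  \sum_(m <= i < m + N) u i <= 2 * K / 2 ^+ m - 2 * K / 2 ^+ (m + N).
Proof.
move=> h; elim: N => [|N IH]; first by rewrite addn0 big_geq // subrr.
rewrite addnS big_nat_recr ?leq_addr //=.
apply: le_trans (lerD IH (h _)) _; rewrite exprS.
have n0 k : (2 : R) ^+ k != 0 by rewrite expf_neq0.
rewrite [X in _ <= X](_ : _ = 2 * K / 2 ^+ m - 2 * K / 2 ^+ (m + N) + K / 2 ^+ (m + N)) //.
by field; rewrite !n0.
Qed.

Lemma geometric_series_cvg u K : (forall i, `|u i| <= K / 2 ^+ i) ->
  exists l, forall N, `|l - \sum_(i < N) u i| <= 2 * K / 2 ^+ N.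
Proof.
move=> h.
have K0 : 0 <= K by have := le_trans (normr_ge0 _) (h 0%N); rewrite expr0 divr1.
have gap m N : (m <= N)%N -> `|\sum_(i < N) u i - \sum_(i < m) u i| <= 2 * K / 2 ^+ m.
  move=> mN; rewrite -!(big_mkord xpredT) (big_cat_nat (n := m)) //= addrAC subrr add0r.
  rewrite -(subnKC mN); apply: le_trans (ler_norm_sum _ _ _) _.
  apply: le_trans (@sum_geometric_le (fun i => `|u i|) K m (N - m) h) _.
  by rewrite gerBl !mulr_ge0 // invr_ge0 exprn_ge0.
have cv : cvgn (series u).
  apply: normed_cvg; apply: (@series_le_cvg _ _ (geometric K 2^-1)).
  - by move=> n /=.
  - by move=> n /=; rewrite mulr_ge0 // exprn_ge0 // invr_ge0.
  - by move=> n /=; rewrite exprVn.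
  - by apply: is_cvg_geometric_series; rewrite ger0_norm ?invr_ge0 // invf_lt1 // ltr1n.
exists (limn (series u)) => N.
apply/ler_addgt0Pr => e e0.
move/cvgrPdist_le: (cv) => /(_ e e0)[M _ HM].
have := HM (maxn M N) (leq_maxl _ _) => /= H1.
have := gap N (maxn M N) (leq_maxr _ _).
rewrite /series /= big_mkord in H1.
set L := limn _ in H1 *; set A := \sum_(i < maxn _ _) _ in H1 *; set B := \sum_(i < N) _.
move=> H2; have -> : L - B = (L - A) + (A - B) by ring.
apply: le_trans (ler_normD _ _) _; lra.
Qed.

End real_limits.

(** * Rapidly convergent series of monomials *)

Lemma derive_of_taylor2 (K : numFieldType) (F : K^o -> K^o) (z l : K^o) (B : K) :
  (forall h, `|h| <= 1 -> `|F (z + h) - F z - h * l| <= B * `|h| ^+ 2) ->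
  derivable F z 1 /\ F^`() z = l.
Proof.
move=> T2.
have B0 : 0 <= B.
  have := T2 1; rewrite normr1 expr1n mulr1 => /(_ (lexx _)).
  exact: le_trans.
have cv : (fun h : K => h^-1 *: (F (h + z) - F z)) @ 0^' --> l.
  apply/cvgrPdist_le => /= e e0.
  near=> h.
  have hn0 : h != 0 by near: h; exact: nbhs_dnbhs_neq.
  have h0 : 0 < `|h| by rewrite normr_gt0.
  have -> : l - h^-1 *: (F (h + z) - F z) = - (h^-1 * (F (z + h) - F z - h * l)).
    by rewrite [h + z]addrC /GRing.scale /=; field.
  rewrite normrN normrM normfV ler_pdivrMl //.
  apply: le_trans (T2 h _) _.
    near: h; apply: dnbhs0_le; exact: ltr01.
  rewrite expr2 mulrCA ler_wpM2l // (le_trans (ler_wpM2r (ltW h0) (ler_wpDr ler01 (lexx B)))) //.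
  rewrite -ler_pdivlMl ?ltr_wpDl //.
  by near: h; apply: dnbhs0_le; rewrite mulr_gt0 // invr_gt0 ltr_wpDl.
split; last by apply: cvg_lim => //; exact: norm_hausdorff.
apply/cvg_ex; exists l => /=; move: cv.
rewrite (_ : (fun h => h^-1 *: (F (h + z) - F z)) =
             (fun h => h^-1 *: (F (h *: (1 : K^o) + z) - F z))) //.
by apply/funext => h; rewrite /GRing.scale /= mulr1.
Unshelve. all: end_near.
Qed.

Section monomial_series.
Variable R : realType.
Implicit Types (c : nat -> R[i]) (d : nat -> nat) (F G : Cplx R -> Cplx R).

Definition partial_sum c d N (z : R[i]) : R[i] := \sum_(i < N) c i * z ^+ d i.

(** Normal convergence, at a geometric rate and on every disk, of the series
    of the monomials c_i z^(d_i).  The exponents d_i are kept apart from the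
    indices i so that a lacunary series needs no zero coefficients. *)
Definition rapid c d := forall rho : R, 1 <= rho ->
  exists K, forall i, cmod (c i) * rho ^+ d i <= K / 2 ^+ i.

(** F is the sum of the series, with a geometric rate that is uniform on each
    disk. *)
Definition rapid_sum c d F := forall rho : R, 1 <= rho ->
  exists K, forall z, cmod z <= rho ->
    forall N, cmod (F z - partial_sum c d N z) <= K / 2 ^+ N.

Lemma rapid_term c d (rho K : R) (z : R[i]) i : cmod z <= rho ->
  cmod (c i) * rho ^+ d i <= K / 2 ^+ i -> cmod (c i * z ^+ d i) <= K / 2 ^+ i.
Proof.
move=> zr; apply: le_trans; rewrite cmodM cmodX ler_wpM2l ?cmod_ge0 //.
by rewrite lerXn2r // nnegrE ?cmod_ge0 // (le_trans (cmod_ge0 z)).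
Qed.

Lemma partial_sum_gap c d (K : R) (z : R[i]) m k :
  (forall i, cmod (c i * z ^+ d i) <= K / 2 ^+ i) ->
  cmod (partial_sum c d (m + k) z - partial_sum c d m z) <= 2 * K / 2 ^+ m.
Proof.
move=> h; rewrite /partial_sum -!(big_mkord xpredT (fun i => c i * z ^+ d i)).
rewrite (big_cat_nat (n := m)) ?leq_addr //= addrAC subrr add0r.
apply: le_trans (cmod_sum _ _ _) _.
apply: le_trans (@sum_geometric_le _ (fun i => cmod (c i * z ^+ d i)) K m k h) _.
rewrite gerBl divr_ge0 ?exprn_ge0 // mulr_ge0 //.
by have := le_trans (cmod_ge0 _) (h 0%N); rewrite expr0 divr1.
Qed.

Lemma partial_sum_cvg c d (K : R) (z : R[i]) :
  (forall i, cmod (c i * z ^+ d i) <= K / 2 ^+ i) ->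
  exists w : R[i], forall N, cmod (w - partial_sum c d N z) <= 4 * K / 2 ^+ N.
Proof.
move=> h.
have [|a Ha] := @geometric_series_cvg _ (fun i => complex.Re (c i * z ^+ d i)) K.
  by move=> i; apply: le_trans (Re_le_cmod _) (h i).
have [|b Hb] := @geometric_series_cvg _ (fun i => complex.Im (c i * z ^+ d i)) K.
  by move=> i; apply: le_trans (Im_le_cmod _) (h i).
exists (a +i* b) => N; apply: le_trans (cmod_le_ReIm _) _.
have -> : complex.Re ((a +i* b) - partial_sum c d N z) =
          a - \sum_(i < N) complex.Re (c i * z ^+ d i).
  rewrite -(raddf_sum (@complex.Re R : Rcomplex R -> R)) /partial_sum.
  by case: (\sum_(i < N) _).
have -> : complex.Im ((a +i* b) - partial_sum c d N z) =
          b - \sum_(i < N) complex.Im (c i * z ^+ d i).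
  rewrite -(raddf_sum (@complex.Im R : Rcomplex R -> R)) /partial_sum.
  by case: (\sum_(i < N) _).
have := lerD (Ha N) (Hb N).
by have -> : 2 * K / 2 ^+ N + 2 * K / 2 ^+ N = 4 * K / 2 ^+ N by ring.
Qed.

Lemma rapid_sum_exists c d : rapid c d -> exists F, rapid_sum c d F.
Proof.
move=> rc.
have ptw (z : Cplx R) : exists w : Cplx R, exists K0 : R,
    forall N, cmod (w - partial_sum c d N z) <= K0 / 2 ^+ N.
  have [|K0 HK0] := rc (Num.max 1 (cmod z)); first by rewrite le_max lexx.
  have [|w Hw] := @partial_sum_cvg c d K0 z; last by exists w, (4 * K0).
  by move=> i; apply: rapid_term (HK0 i); rewrite le_max lexx orbT.
have [F HF] := choice ptw.
exists F => rho rho1; have [K HK] := rc rho rho1; exists (2 * K) => z zr N.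
have [K0 HK0] := HF z.
apply: (@le_of_geometric_error _ _ _ K0) => m.
have h i : cmod (c i * z ^+ d i) <= K / 2 ^+ i by exact: rapid_term (HK i).
have gap := @partial_sum_gap c d K z N m h.
rewrite -(subrK (partial_sum c d (N + m) z) (F z)) -addrA.
apply: le_trans (le_normcD _ _) _; rewrite [X in X <= _]addrC; apply: lerD => //.
apply: le_trans (HK0 _) _.
have K0ge : 0 <= K0 by have := le_trans (cmod_ge0 _) (HK0 0%N); rewrite expr0 divr1.
by rewrite ler_wpM2l // lef_pV2 ?posrE ?exprn_gt0 // ler_eXn2l ?ltr1n // leq_addl.
Qed.

(** The coefficients of the termwise derivative, the exponents becoming
    (d i).-1. *)
Definition dcoef c d i := c i * (d i)%:R.

(** The factor d_i <= 2^(d_i) is absorbed by doubling rho. *)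
Lemma rapid_deriv c d : rapid c d -> rapid (dcoef c d) (fun i => (d i).-1).
Proof.
move=> rc rho rho1; have [|K HK] := rc (2 * rho); first by lra.
exists K => i; apply: le_trans (HK i).
rewrite /dcoef cmodM -mulrA ler_wpM2l ?cmod_ge0 //.
have -> : cmod ((d i)%:R : R[i]) = (d i)%:R.
  by rewrite -(rmorph_nat (real_complex R)) cmodR.
rewrite exprMn; apply: ler_pM; rewrite ?exprn_ge0 //; first lra.
  by rewrite -natrX ler_nat ltnW // ltn_expl.
by rewrite ler_weXn2l // leq_pred.
Qed.

Lemma expr_taylor2 (z h : R[i]) (rho : R) n : 1 <= rho ->
  cmod z <= rho -> cmod (z + h) <= rho ->
  cmod ((z + h) ^+ n - z ^+ n - h * (n%:R * z ^+ n.-1)) <=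
  cmod h ^+ 2 * (4 * rho) ^+ n.
Proof.
move=> rho1 zr zhr.
elim: n => [|n IH].
  rewrite !expr0 subrr mul0r mulr0 subr0 ComplexField.Normc.normc0 mulr1.
  by rewrite exprn_ge0 // cmod_ge0.
have -> : (z + h) ^+ n.+1 - z ^+ n.+1 - h * (n.+1%:R * z ^+ n.+1.-1) =
  (z + h) * ((z + h) ^+ n - z ^+ n - h * (n%:R * z ^+ n.-1)) +
  h ^+ 2 * (n%:R * z ^+ n.-1).
  case: n {IH} => [|n] /=; first by rewrite !expr0 !expr1; ring.
  rewrite !exprS -[n.+2]addn1 -[n.+1]addn1 !natrD; ring.
apply: le_trans (le_normcD _ _) _; rewrite !cmodM !cmodX.
have cn : cmod (n%:R : R[i]) = n%:R by rewrite -(rmorph_nat (real_complex R)) cmodR.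
rewrite cn.
have n4 : n%:R <= 4 ^+ n :> R by rewrite -natrX ler_nat ltnW // ltn_expl.
have r0 : 0 <= rho by lra.
have B1 : n%:R * cmod z ^+ n.-1 <= (4 * rho) ^+ n.
  rewrite exprMn; apply: ler_pM => //; rewrite ?exprn_ge0 ?cmod_ge0 //.
  apply: (@le_trans _ _ (rho ^+ n.-1)); last by rewrite ler_weXn2l // leq_pred.
  by rewrite lerXn2r // nnegrE ?cmod_ge0.
have B2 : cmod (z + h) * cmod ((z + h) ^+ n - z ^+ n - h * (n%:R * z ^+ n.-1)) <=
   rho * (cmod h ^+ 2 * (4 * rho) ^+ n).
  by apply: ler_pM => //; rewrite cmod_ge0.
apply: le_trans (lerD B2 (ler_wpM2l (exprn_ge0 2 (cmod_ge0 h)) B1)) _.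
rewrite [(4 * rho) ^+ n.+1]exprS.
have := mulr_ge0 (exprn_ge0 2 (cmod_ge0 h)) (exprn_ge0 n (mulr_ge0 (ler0n R 4) r0)).
move=> X0; rewrite [X in _ <= X]mulrCA; move: X0; set X := cmod h ^+ 2 * _ => X0.
have : 0 <= (rho - 1) * X by rewrite mulr_ge0 // subr_ge0.
lra.
Qed.

(** For the partial sums the bound follows from [expr_taylor2], with a constant
    that does not depend on the number of terms. *)
Lemma rapid_sum_taylor2 c d F G (z : R[i]) : rapid c d -> rapid_sum c d F ->
  rapid_sum (dcoef c d) (fun i => (d i).-1) G ->
  exists K, forall h, cmod h <= 1 ->
    cmod (F (z + h) - F z - h * G z) <= K * cmod h ^+ 2.
Proof.
move=> rc sF sG; pose rho := 1 + cmod z.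
have rho1 : 1 <= rho by rewrite lerDl cmod_ge0.
have zr : cmod z <= rho by rewrite lerDr.
have [|K HK] := rc (4 * rho); first by lra.
have [KF HF] := sF rho rho1; have [KG HG] := sG rho rho1.
exists (2 * K) => h h1.
have zhr : cmod (z + h) <= rho.
  by apply: le_trans (le_normcD _ _) _; rewrite addrC lerD2r.
apply: (@le_of_geometric_error _ _ _ (KF + KF + KG)) => N.
set S := partial_sum c d N; set S' := partial_sum (dcoef c d) (fun i => (d i).-1) N.
have -> : F (z + h) - F z - h * G z =
  (S (z + h) - S z - h * S' z) + ((F (z + h) - S (z + h)) + (S z - F z) + h * (S' z - G z)).
  ring.
apply: le_trans (le_normcD _ _) _; apply: lerD.
  rewrite /S /S' /partial_sum mulr_sumr -!sumrB.
  apply: le_trans (cmod_sum _ _ _) _.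
  apply: (@le_trans _ _ (\sum_(i < N) (K / 2 ^+ i) * cmod h ^+ 2)).
    apply: ler_sum => i _.
    have -> : c i * (z + h) ^+ d i - c i * z ^+ d i - h * (dcoef c d i * z ^+ (d i).-1) =
      c i * ((z + h) ^+ d i - z ^+ d i - h * ((d i)%:R * z ^+ (d i).-1)).
      by rewrite /dcoef; ring.
    rewrite cmodM; apply: le_trans (ler_wpM2l (cmod_ge0 _) (expr_taylor2 (d i) rho1 zr zhr)) _.
    by rewrite mulrCA mulrC ler_wpM2r // exprn_ge0 // cmod_ge0.
  rewrite -mulr_suml ler_wpM2r ?exprn_ge0 ?cmod_ge0 //.
  rewrite -(big_mkord xpredT (fun i => K / 2 ^+ i)).
  apply: le_trans (@sum_geometric_le _ (fun i => K / 2 ^+ i) K 0 N _) _ => //.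
  rewrite expr0 divr1 gerBl divr_ge0 ?exprn_ge0 // mulr_ge0 //.
  by have := le_trans (mulr_ge0 (cmod_ge0 _) (exprn_ge0 _ _)) (HK 0%N); rewrite expr0 divr1; apply; lra.
apply: le_trans (le_normcD _ _) _; rewrite !mulrDl; apply: lerD.
  apply: le_trans (le_normcD _ _) _; apply: lerD; first exact: HF.
  by rewrite cmodB; exact: HF.
rewrite cmodM cmodB; apply: le_trans (HG z zr N).
by rewrite ler_piMl ?cmod_ge0.
Qed.

Lemma rapid_sum_derive c d F G : rapid c d -> rapid_sum c d F ->
  rapid_sum (dcoef c d) (fun i => (d i).-1) G ->
  forall z : Cplx R, derivable F z 1 /\ F^`() z = G z.
Proof.
move=> rc sF sG z.
have [K HK] := rapid_sum_taylor2 z rc sF sG.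
apply: (@derive_of_taylor2 _ F z (G z) K%:C) => h h1.
rewrite !normE -rmorphXn -rmorphM lecR; apply: HK.
by rewrite -lecR -normE.
Qed.

End monomial_series.

Section iterated_derivatives.
Variable R : realType.
Implicit Types (c : nat -> R[i]) (d : nat -> nat) (F G : Cplx R -> Cplx R).

Definition dncoef c d n i := c i * (d i ^_ n)%:R.

Lemma rapid_sum_derive1n c d F : rapid c d -> rapid_sum c d F -> forall n,
  rapid (dncoef c d n) (fun i => d i - n)%N /\
  rapid_sum (dncoef c d n) (fun i => d i - n)%N F^`(n).
Proof.
move=> rc sF; elim=> [|n [rn sn]].
  have -> : dncoef c d 0 = c by apply/funext => i; rewrite /dncoef ffactn0 mulr1.
  by have -> : (fun i => d i - 0)%N = d by apply/funext => i; rewrite subn0.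
have Ec : dcoef (dncoef c d n) (fun i => d i - n)%N = dncoef c d n.+1.
  by apply/funext => i; rewrite /dcoef /dncoef ffactnSr natrM mulrA.
have Ed : (fun i => (d i - n).-1)%N = (fun i => d i - n.+1)%N.
  by apply/funext => i; rewrite subnS.
have rn1 := rapid_deriv rn; rewrite Ec Ed in rn1.
have [G sG] := rapid_sum_exists rn1; split => //.
rewrite derive1nS; suff -> : F^`(n)^`() = G by [].
apply/funext => z; apply: (rapid_sum_derive rn sn _ z).2.
by rewrite Ec Ed.
Qed.

Lemma cmod_bounded_subsequence (u : nat -> R[i]) (B : R) :
  (forall n, cmod (u n) <= B) -> exists (l : R[i]) (f : nat -> nat),
    (forall n, (n <= f n)%N) /\
    forall e, 0 < e -> exists N, forall n, (N <= n)%N -> cmod (u (f n) - l) <= e.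
Proof.
move=> uB.
have bnd (v : nat -> R) : (forall n, `|v n| <= B) -> bounded_fun v.
  move=> vB; exists B; split; first exact: num_real.
  by move=> x Bx n _; apply: le_trans (vB n) (ltW Bx).
have inc (f : nat -> nat) : increasing_seq f -> forall n, (n <= f n)%N.
  move=> fi; elim=> // n IH; apply: leq_ltn_trans IH _.
  by have := fi n.+1 n; rewrite leEnat ltnn ltnNge => ->.
have [f fi cf] := bolzano_weierstrass (bnd (fun n => complex.Re (u n)) (fun n => le_trans (Re_le_cmod _) (uB n))).
have [g gi cg] := bolzano_weierstrass (bnd (fun n => complex.Im (u (f n))) (fun n => le_trans (Im_le_cmod _) (uB _))).
exists (limn ((fun n => complex.Re (u n)) \o f) +i* limn ((fun n => complex.Im (u (f n))) \o g)).
exists (f \o g); split=> [n|e e0].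
  by apply: leq_trans (inc _ gi n) (inc _ fi _).
have e20 : 0 < e / 2 by rewrite divr_gt0.
move/cvgrPdist_le: cf => /(_ _ e20)[N1 _ H1].
move/cvgrPdist_le: cg => /(_ _ e20)[N2 _ H2].
exists (maxn N1 N2) => n; rewrite geq_max => /andP[n1 n2].
rewrite cmodB; apply: le_trans (cmod_le_ReIm _) _.
have := H1 (g n) (leq_trans n1 (inc _ gi n)); have := H2 n n2 => /=.
case: (u (f (g n))) => x y /=.
lra.
Qed.

(** The zeros of the partial sums accumulate somewhere, by the theorem of
    Bolzano and Weierstrass applied to real and imaginary parts; the Taylor
    bound gives the continuity of F there. *)
Lemma rapid_sum_zero c d F (a : R[i]) (s : R) : rapid c d -> rapid_sum c d F ->
  (exists N0, forall N, (N0 <= N)%N ->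
    exists2 z, partial_sum c d N z = 0 & cmod (z - a) <= s) ->
  exists2 z, F z = 0 & cmod (z - a) <= s.
Proof.
move=> rc sF [N0 HN].
have ptw n : exists z, partial_sum c d (N0 + n) z = 0 /\ cmod (z - a) <= s.
  by have [z] := HN (N0 + n)%N (leq_addr _ _); exists z.
have [u Hu] := choice ptw.
pose rho := 1 + s + cmod a.
have s0 : 0 <= s := le_trans (cmod_ge0 _) (Hu 0%N).2.
have rho1 : 1 <= rho by rewrite /rho; have := cmod_ge0 a; lra.
have ur n : cmod (u n) <= rho.
  rewrite -(subrK a (u n)); apply: le_trans (le_normcD _ _) _.
  by have := (Hu n).2; rewrite /rho; lra.
have [l [f [fn ful]]] := cmod_bounded_subsequence ur.
exists l; last first.
  apply/ler_addgt0Pr => e e0; have [N HN'] := ful e e0.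
  have -> : l - a = (u (f N) - a) + (l - u (f N)) by ring.
  apply: le_trans (le_normcD _ _) _; apply: lerD; first exact: (Hu _).2.
  by rewrite cmodB HN'.
have [G sG] := rapid_sum_exists (rapid_deriv rc).
have [K HK] := rapid_sum_taylor2 l rc sF sG.
have [KF HF] := sF rho rho1.
have KF0 : 0 <= KF by have := le_trans (cmod_ge0 _) (HF (u 0%N) (ur _) 0%N); rewrite expr0 divr1.
apply: ComplexField.Normc.eq0_normc; apply/eqP; rewrite eq_le cmod_ge0 andbT.
apply: (@le_of_geometric_error _ _ _ (KF + (cmod (G l) + `|K|))) => n; rewrite add0r.
have en0 : 0 < 2 ^- n :> R by rewrite invr_gt0 exprn_gt0.
have [N HN'] := ful _ en0.
pose m := maxn N n; have := HN' m (leq_maxl _ _); set h := u (f m) - l => hn.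
have h1 : cmod h <= 1 by apply: le_trans hn _; rewrite invf_le1 ?exprn_gt0 // exprn_ege1 // ler1n.
have := HK h h1; rewrite /h (addrC l) subrK -/h => T.
have Fu : cmod (F (u (f m))) <= KF / 2 ^+ n.
  have := HF _ (ur (f m)) (N0 + f m)%N; rewrite (Hu _).1 subr0 => /le_trans; apply.
  rewrite ler_wpM2l // lef_pV2 ?posrE ?exprn_gt0 // ler_eXn2l ?ltr1n //.
  by rewrite (leq_trans (leq_maxr N n)) // (leq_trans (fn _)) // leq_addl.
have -> : F l = F (u (f m)) - (F (u (f m)) - F l - h * G l) - h * G l by ring.
apply: le_trans (le_normcD _ _) _; rewrite normcN cmodM.
apply: le_trans (lerD (le_normcD _ _) (lexx _)) _; rewrite normcN.
have h0 := cmod_ge0 h; have G0 := cmod_ge0 (G l).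
have A1 : cmod h * cmod (G l) <= cmod (G l) / 2 ^+ n by rewrite mulrC ler_wpM2l.
have A2 : K * cmod h ^+ 2 <= `|K| / 2 ^+ n.
  apply: (@le_trans _ _ (`|K| * cmod h ^+ 2)).
    by rewrite ler_wpM2r ?exprn_ge0 // ler_norm.
  by rewrite ler_wpM2l // expr2 (le_trans _ hn) // ler_piMl.
lra.
Qed.
End iterated_derivatives.

(** * Zeros near a circle where two terms balance *)

(** The binomial expansion of the left side has the moduli of its terms on the
    right side; the induction avoids writing it. *)
Lemma expr1D_linear_error (R : rcfType) (v : R[i]) N :
  cmod ((1 + v) ^+ N - 1 - N%:R * v) <= (1 + cmod v) ^+ N - 1 - N%:R * cmod v.
Proof.
elim: N => [|N IH].
  by rewrite !expr0 !mul0r !subrr ComplexField.Normc.normc0.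
have -> : (1 + v) ^+ N.+1 - 1 - N.+1%:R * v =
    (1 + v) * ((1 + v) ^+ N - 1 - N%:R * v) + N%:R * v ^+ 2.
  by rewrite exprS -[N.+1]addn1 natrD; ring.
have -> : (1 + cmod v) ^+ N.+1 - 1 - N.+1%:R * cmod v =
    (1 + cmod v) * ((1 + cmod v) ^+ N - 1 - N%:R * cmod v) + N%:R * cmod v ^+ 2.
  by rewrite exprS -[N.+1]addn1 natrD; ring.
apply: le_trans (le_normcD _ _) _; rewrite (cmodM (1 + v)) (cmodM N%:R) cmodX.
have -> : cmod (N%:R : R[i]) = N%:R by rewrite -(rmorph_nat (real_complex R)) cmodR.
rewrite lerD2r; apply: ler_pM => //; rewrite ?cmod_ge0 //.
by apply: le_trans (le_normcD _ _) _; rewrite ComplexField.Normc.normc1.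
Qed.

(** The linear term has modulus 1/4, and the others add up to at most
    4/3 - 1 - 1/4 = 1/12. *)
Lemma expr1D_sub1_lb (R : rcfType) (v : R[i]) N :
  N%:R * cmod v = 1 / 4 -> 1 / 6 <= cmod (1 - (1 + v) ^+ N).
Proof.
move=> Nv; have v0 := cmod_ge0 v.
have h1 := expr1D_linear_error v N; have h2 := expr1D_le v0 Nv.
rewrite Nv in h1.
have Nr : cmod (N%:R * v) = 1 / 4.
  by rewrite cmodM -(rmorph_nat (real_complex R)) cmodR.
have := cmod_le_sub (N%:R * v) (- ((1 + v) ^+ N - 1 - N%:R * v)).
rewrite normcN Nr.
have -> : N%:R * v - - ((1 + v) ^+ N - 1 - N%:R * v) = (1 + v) ^+ N - 1 by ring.
rewrite [cmod (1 - _)]cmodB; lra.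
Qed.

Section zero_near.
Variables (R : realType) (c : nat -> R[i]) (d : nat -> nat).

(** The terms j and j.+1 add up to c_j z^(d_j) (1 - (z / a)^N), which vanishes
    at a.  On the circle of radius tau |a| around a, its modulus is at least
    |c_j z^(d_j)| / 6 by [expr1D_sub1_lb], and in the closed disk all the other
    terms together are at most |c_j z^(d_j)| / 18.  Hence [root_in_disk] applies
    with B = |c_j| / 18 and k = d_j, as 1/6 - 1/18 = 2/18. *)
Lemma zero_near (j N : nat) (a : R[i]) (tau : R) :
  c j != 0 -> a != 0 -> d j.+1 = (d j + N)%N -> c j.+1 * a ^+ N = - c j ->
  0 < tau -> N%:R * tau = 1 / 4 ->
  (forall r, cmod a * (1 - tau) <= r -> r <= cmod a * (1 + tau) ->
    [/\ forall i, (i < j)%N -> cmod (c i) * r ^+ d i <= cmod (c i.+1) * r ^+ d i.+1 / 100,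
        forall i, (j < i)%N -> cmod (c i.+1) * r ^+ d i.+1 <= cmod (c i) * r ^+ d i / 100 &
        cmod (c j.+1) * r ^+ d j.+1 <= 4 / 3 * (cmod (c j) * r ^+ d j)]) ->
  forall J, (j.+2 <= J)%N ->
  exists2 z, partial_sum c d J z = 0 & cmod (z - a) <= cmod a * tau.
Proof.
move=> cj0 a0 dj ca tau0 Ntau dom J jJ.
have rho0 : 0 < cmod a.
  rewrite lt_neqAle cmod_ge0 andbT eq_sym; apply: contra_neq a0 => /ComplexField.Normc.eq0_normc.
  by move=> ->.
have cjp : 0 < cmod (c j).
  rewrite lt_neqAle cmod_ge0 andbT eq_sym; apply: contra_neq cj0 => /ComplexField.Normc.eq0_normc.
  by move=> ->.
have tau1 : tau <= 1 / 4.
  rewrite -Ntau ler_peMl ?(ltW tau0) // ler1n lt0n.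
  by apply/eqP => N0; move: Ntau; rewrite N0 mul0r; lra.
have split w : cmod a * (1 - tau) <= cmod w -> cmod w <= cmod a * (1 + tau) ->
    cmod (partial_sum c d J w - c j * w ^+ d j * (1 - (w / a) ^+ N)) <=
    cmod (c j) * cmod w ^+ d j / 18.
  move=> lo hi; have [Tl Tr Tm] := dom _ lo hi.
  pose F i := c i * w ^+ d i.
  have -> : partial_sum c d J w - c j * w ^+ d j * (1 - (w / a) ^+ N) =
      \sum_(0 <= i < j) F i + \sum_(j.+2 <= i < J) F i.
    rewrite /partial_sum -(big_mkord xpredT F) (big_cat_nat (n := j.+2)) //=.
    rewrite !big_nat_recr //=.
    have -> : F j.+1 = - (c j * w ^+ d j * (w / a) ^+ N).
      have -> : F j.+1 = c j.+1 * a ^+ N * (w ^+ d j * (w / a) ^+ N).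
        rewrite /F dj exprD expr_div_n.
        have : a ^+ N != 0 by rewrite expf_neq0.
        by move=> ?; field.
      by rewrite ca; ring.
    by rewrite /F; ring.
  have T0 i : 0 <= cmod (c i) * cmod w ^+ d i.
    by rewrite mulr_ge0 ?exprn_ge0 ?cmod_ge0.
  have := @neighbours_sum_le _ (fun i => cmod (c i) * cmod w ^+ d i) j (J - j.+2) T0 Tl Tr Tm.
  rewrite subnKC //; apply: le_trans.
  apply: le_trans (le_normcD _ _) _; apply: lerD.
    apply: le_trans (cmod_sum _ _ _) _.
    by apply: ler_sum => i _; rewrite /F cmodM cmodX.
  apply: le_trans (cmod_sum _ _ _) _.
  by apply: ler_sum => i _; rewrite /F cmodM cmodX.
pose P : {poly R[i]} := \sum_(i < J) c i *: 'X^(d i).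
have PE w : P.[w] = partial_sum c d J w.
  by rewrite /P horner_sum; apply: eq_bigr => i _; rewrite hornerZ hornerXn.
have := @root_in_disk _ P a (cmod a * tau)%:C (cmod (c j) / 18)%:C (d j).
have s0 : 0 < cmod a * tau by rewrite mulr_gt0.
case.
- by rewrite ltcR.
- rewrite normE -(rmorph_nat (real_complex R) 2) -rmorphM lecR mulrCA ler_piMr ?(ltW rho0) //.
  lra.
- by rewrite ltcR divr_gt0.
- rewrite PE !normE -rmorphXn -rmorphM lecR.
  have := split a; rewrite divff // expr1n subrr mulr0 subr0 mulrAC; apply.
    by rewrite ler_piMr ?cmod_ge0 //; lra.
  by rewrite ler_peMr ?cmod_ge0 //; lra.
- move=> w; rewrite !normE PE => /complexI ws.
  rewrite -(rmorph_nat (real_complex R) 2) -rmorphXn -!rmorphM lecR.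
  pose v := (w - a) / a.
  have cv : cmod v = tau.
    by rewrite /v cmodM ComplexField.Normc.normcV ws mulrAC divff ?mul1r // gt_eqF.
  have wa : w / a = 1 + v by rewrite /v; field.
  have low : 1 / 6 <= cmod (1 - (w / a) ^+ N).
    by rewrite wa; apply: expr1D_sub1_lb; rewrite cv.
  have := split w; set Q := c j * w ^+ d j * _ => sp.
  have cQ : cmod (c j) * cmod w ^+ d j / 6 <= cmod Q.
    rewrite /Q cmodM cmodM cmodX ler_wpM2l ?mulr_ge0 ?exprn_ge0 ?cmod_ge0 //.
    by rewrite -[6^-1]mul1r.
  have w1 : cmod a * (1 - tau) <= cmod w.
    have := cmod_le_sub a (a - w); rewrite (cmodB a w) ws opprB addrCA subrr addr0 mulrBr mulr1.
    exact.
  have w2 : cmod w <= cmod a * (1 + tau).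
    have := le_normcD a (w - a); rewrite ws addrCA subrr addr0 mulrDr mulr1.
    exact.
  have sp' := sp w1 w2.
  have := cmod_le_sub Q (Q - partial_sum c d J w).
  rewrite (cmodB Q (partial_sum _ _ _ _)) opprB addrCA subrr addr0.
  have := mulr_ge0 (ltW cjp) (exprn_ge0 (d j) (cmod_ge0 w)).
  lra.
move=> z rz; rewrite normE ltcR => za; exists z; last exact: ltW.
by rewrite -PE; apply/eqP; rewrite -rootE.
Qed.

End zero_near.

(** * Roots of -1 in a prescribed direction *)

Section directions.
Variable R : realType.

Definition cis (t : R) : R[i] := cos t +i* sin t.

Lemma cisX t n : cis t ^+ n = cis (n%:R * t).
Proof.
elim: n => [|n IH]; first by rewrite mul0r /cis cos0 sin0 expr0.
rewrite exprS IH -addn1 natrD mulrDl mul1r addrC /cis cosD sinD.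
by apply/eqP; rewrite eq_complex /=; apply/andP; split; apply/eqP; ring.
Qed.

Lemma cis_onto (u : R[i]) : cmod u = 1 -> exists2 t : R, 0 <= t & u = cis t.
Proof.
case: u => a b /= ab1.
have ab : a ^+ 2 + b ^+ 2 = 1.
  by rewrite -[LHS]sqr_sqrtr ?addr_ge0 ?sqr_ge0 // ab1 expr1n.
have a1 : -1 <= a <= 1.
  rewrite -ler_norml -(@expr_le1 _ 2) // real_normK ?num_real //.
  by rewrite -ab lerDl sqr_ge0.
have b2 : 1 - a ^+ 2 = b ^+ 2 by rewrite -ab; ring.
have [b0|b0] := leP 0 b.
  exists (acos a); first exact: acos_ge0.
  by rewrite /cis acosK ?in_itv // sin_acos // b2 sqrtr_sqr ger0_norm.
exists (pi *+ 2 - acos a).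
  by have := acos_lepi a1; have := pi_ge0 R; rewrite mulr2n; lra.
rewrite /cis cosB sinB cos2pi sin2pi acosK ?in_itv // sin_acos // b2 sqrtr_sqr.
by rewrite ltr0_norm // !mul1r !mul0r addr0 sub0r opprK.
Qed.

Lemma cis_odd_pi l : cis ((2 * l + 1)%:R * pi) = -1.
Proof.
have -> : (2 * l + 1)%:R * pi = pi + (pi *+ 2) *+ l :> R.
  by rewrite -mulrnA natrD mulrDl mul1r mulr_natl addrC.
rewrite /cis (periodicn (@cosD2pi R)) (periodicn (@sinD2pi R)) cospi sinpi.
by apply/eqP; rewrite eq_complex /= oppr0 !eqxx.
Qed.

(** The roots of -1 of order N are the points of argument (2 l + 1) pi / N. *)
Lemma roots_of_m1_dense (u : R[i]) (e : R) : cmod u = 1 -> 0 < e ->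
  exists N0, forall N, (N0 <= N)%N ->
    exists2 w : R[i], w ^+ N = -1 & cmod (w - u) <= e.
Proof.
move=> u1 e0; have [t t0 ->] := cis_onto u1.
have e20 : 0 < e / 2 by rewrite divr_gt0.
have := @continuous_cos R t => /cvgrPdist_le /(_ _ e20) /nbhs_ballP[d1 /= d10 H1].
have := @continuous_sin R t => /cvgrPdist_le /(_ _ e20) /nbhs_ballP[d2 /= d20 H2].
pose d := Num.min d1 d2; have d0 : 0 < d by rewrite lt_min d10.
exists (Num.truncn (pi / d)).+1 => N hN.
have N0 : 0 < N%:R :> R by rewrite ltr0n (leq_trans _ hN).
have Nd : pi / N%:R < d.
  rewrite ltr_pdivrMr // mulrC -ltr_pdivrMr //.
  by apply: lt_le_trans (truncnS_gt _) _; rewrite ler_nat.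
have pi0 := pi_gt0 R.
pose l := Num.truncn (t * N%:R / (pi *+ 2)).
have p20 : 0 < pi *+ 2 :> R by rewrite pmulrn_lgt0.
have /andP[llo lhi] := truncn_itv (divr_ge0 (mulr_ge0 t0 (ltW N0)) (ltW p20)).
rewrite -/l ler_pdivlMr // in llo; rewrite -/l ltr_pdivrMr // in lhi.
pose s : R := (2 * l%:R + 1) * pi / N%:R.
have st : `|t - s| < d.
  apply: le_lt_trans Nd; rewrite /s.
  rewrite ler_norml lerBlDr lerBrDr -mulrDl -mulNr -mulrDl.
  rewrite ler_pdivrMr // ler_pdivlMr //.
  rewrite -[l.+1]addn1 natrD mulr2n in lhi; rewrite mulr2n in llo.
  by apply/andP; split; lra.
exists (cis s).
  rewrite cisX /s mulrCA divff ?mulr1 ?gt_eqF //.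
  by rewrite -(cis_odd_pi l) natrD natrM.
have c1 := H1 s; have c2 := H2 s.
rewrite /ball /= in c1 c2.
rewrite cmodB; apply: le_trans (cmod_le_ReIm _) _ => /=.
have := c1 (lt_le_trans st _); have := c2 (lt_le_trans st _).
rewrite !ge_min !lexx orbT => /(_ isT) h1 /(_ isT) h2; lra.
Qed.

(** In the application, rho is the radius where two terms whose exponents
    differ by N have the same modulus. *)
Lemma prod_root_exists (N : nat) (P : R) : (0 < N)%N -> 0 < P ->
  exists2 rho : R, 0 < rho & rho ^+ N * P = 1.
Proof.
move=> N0 P0; exists (P^-1 `^ (N%:R^-1)); first by rewrite powR_gt0 // invr_gt0.
rewrite -powR_mulrn ?powR_ge0 // -powRrM mulVf ?pnatr_eq0 -?lt0n //.
by rewrite powRr1 ?invr_ge0 ?ltW // mulVf // gt_eqF.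
Qed.

End directions.

(** * The function and its growth *)

Section the_function.
Variable R : realType.

Lemma expR_term_le (x : R) n : 0 <= x -> x ^+ n / n`!%:R <= expR x.
Proof.
move=> x0; case: n => [|n]; first by rewrite expr0 divr1; have := expR_ge1Dx x; lra.
by have := expR_ge1Dxn n x0; lra.
Qed.

Lemma expR_partial_le (x : R) N : 0 <= x ->
  \sum_(0 <= p < N) x ^+ p / p`!%:R <= expR x.
Proof.
move=> x0.
have -> : \sum_(0 <= p < N) x ^+ p / p`!%:R = series (exp_coeff x) N by [].
apply: (@nondecreasing_cvgn_le _ (series (exp_coeff x))); last exact: is_cvg_series_exp_coeff.
by apply: nondecreasing_series => n _ _; exact: exp_coeff_ge0.
Qed.

Lemma sum_half_exp_le (F : nat -> R) J : (forall p, 0 <= F p) ->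
  \sum_(i < J) F (half_exp i) <= \sum_(0 <= p < half_exp J) F p.
Proof.
move=> F0; elim: J => [|J IH]; first by rewrite big_ord0 big_geq.
rewrite big_ord_recr /= (big_cat_nat (n := half_exp J)) ?leq_addr //=; apply: lerD => //.
rewrite big_ltn; last by rewrite -[ltnLHS]addn0 ltn_add2l gap_gt0.
by rewrite lerDl; apply: sumr_ge0.
Qed.

Definition fcoef i : R[i] := ((half_exp i)`!%:R^-1)%:C.
Definition fdeg i := (half_exp i).*2.

Lemma cmod_fcoef i : cmod (fcoef i) = (half_exp i)`!%:R^-1.
Proof. by rewrite cmodR // invr_ge0. Qed.

Lemma fterm_norm i (r : R) : cmod (fcoef i) * r ^+ fdeg i = (r ^+ 2) ^+ half_exp i / (half_exp i)`!%:R.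
Proof. by rewrite cmod_fcoef mulrC /fdeg -mul2n exprM. Qed.

Lemma rapid_f : rapid fcoef fdeg.
Proof.
move=> rho rho1; exists (expR (2 * rho ^+ 2)) => i.
have r0 : 0 <= rho ^+ 2 by rewrite sqr_ge0.
rewrite fterm_norm ler_pdivlMr ?exprn_gt0 //.
apply: le_trans (expR_term_le (half_exp i) (mulr_ge0 (ler0n R 2) r0)).
have -> : (2 * rho ^+ 2) ^+ half_exp i / (half_exp i)`!%:R =
    (rho ^+ 2) ^+ half_exp i / (half_exp i)`!%:R * 2 ^+ half_exp i.
  by rewrite [(2 * _) ^+ _]exprMn; ring.
rewrite ler_wpM2l ?divr_ge0 ?(exprn_ge0 _ r0) //.
by rewrite ler_weXn2l ?ler1n // half_exp_ge.
Qed.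

Lemma f_ub F (z : Cplx R) : rapid_sum fcoef fdeg F -> cmod (F z) <= expR (cmod z ^+ 2).
Proof.
move=> sF.
have [|K HK] := sF (Num.max 1 (cmod z)); first by rewrite le_max lexx.
apply: (@le_of_geometric_error _ _ _ K) => N.
rewrite -(subrK (partial_sum fcoef fdeg N z) (F z)).
apply: le_trans (le_normcD _ _) _; rewrite addrC; apply: lerD; last first.
  by apply: HK; rewrite le_max lexx orbT.
apply: le_trans (cmod_sum _ _ _) _.
have z0 : 0 <= cmod z ^+ 2 by rewrite sqr_ge0.
apply: (@le_trans _ _ (\sum_(i < N) (fun p => (cmod z ^+ 2) ^+ p / p`!%:R) (half_exp i))).
  by apply: ler_sum => i _; rewrite cmodM cmodX fterm_norm.
have F0 p : 0 <= (cmod z ^+ 2) ^+ p / p`!%:R by rewrite divr_ge0 // exprn_ge0.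
exact: le_trans (sum_half_exp_le N F0) (expR_partial_le _ z0).
Qed.

(** On the positive half line all terms are nonnegative, so the sum is at least
    each of them. *)
Lemma f_lb F (r : R) i : rapid_sum fcoef fdeg F -> 0 <= r ->
  (r ^+ 2) ^+ half_exp i / (half_exp i)`!%:R <= cmod (F r%:C).
Proof.
move=> sF r0.
have [|K HK] := sF (Num.max 1 r); first by rewrite le_max lexx.
have rr : cmod r%:C <= Num.max 1 r by rewrite cmodR // le_max lexx orbT.
apply: (@le_of_geometric_error _ _ _ K) => N; set M := (i.+1 + N)%N.
have HM := HK _ rr M.
have K0 : 0 <= K by have := le_trans (cmod_ge0 _) (HK _ rr 0%N); rewrite expr0 divr1.
have HN : K / 2 ^+ M <= K / 2 ^+ N.
  by rewrite ler_wpM2l // lef_pV2 ?posrE ?exprn_gt0 // ler_eXn2l ?ltr1n // leq_addl.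
have T0 l : 0 <= (r ^+ 2) ^+ half_exp l / (half_exp l)`!%:R by rewrite divr_ge0 // exprn_ge0 // exprn_ge0.
have : (r ^+ 2) ^+ half_exp i / (half_exp i)`!%:R <= cmod (partial_sum fcoef fdeg M r%:C).
  have -> : partial_sum fcoef fdeg M r%:C = (\sum_(l < M) (r ^+ 2) ^+ half_exp l / (half_exp l)`!%:R)%:C.
    rewrite rmorph_sum; apply: eq_bigr => l _.
    by rewrite /fcoef -rmorphXn -rmorphM mulrC /fdeg -mul2n exprM.
  rewrite cmodR; last by apply: sumr_ge0.
  have iM : (i < M)%N by rewrite leq_addr.
  by rewrite (bigD1 (Ordinal iM)) //= lerDl; apply: sumr_ge0.
have := cmod_le_sub (partial_sum fcoef fdeg M r%:C) (F r%:C).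
rewrite cmodB; lra.
Qed.

Lemma f_not_poly F : rapid_sum fcoef fdeg F -> ~ exists p : {poly R[i]}, forall z, F z = p.[z].
Proof.
move=> sF [p Fp].
pose D := size p; pose B : R := \sum_(i < D) cmod p`_i.
have ub r : 1 <= r -> cmod (F r%:C) <= B * r ^+ D.
  move=> r1; rewrite Fp horner_coef mulr_suml; apply: le_trans (cmod_sum _ _ _) _.
  apply: ler_sum => i _; rewrite cmodM cmodX cmodR; last by lra.
  by rewrite ler_wpM2l ?cmod_ge0 // ler_weXn2l // ltnW.
have B0 : 0 <= B by apply: sumr_ge0 => i _; exact: cmod_ge0.
pose q := half_exp D.+1; have qD : (D < q.*2)%N.
  by apply: leq_trans (half_exp_ge D.+1) _; rewrite -addnn leq_addr.
pose r : R := q`!%:R * B + 1.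
have f0 : 0 < q`!%:R :> R by rewrite ltr0n fact_gt0.
have r1 : 1 <= r by rewrite /r lerDr mulr_ge0 // ltW.
have r0 : 0 < r by lra.
have := le_trans (f_lb D.+1 sF (ltW r0)) (ub r r1).
rewrite -/q -exprM mul2n ler_pdivrMr // => h.
have : r ^+ D.+1 <= B * r ^+ D * q`!%:R by apply: le_trans h; rewrite ler_weXn2l.
rewrite exprS mulrAC ler_pM2r ?exprn_gt0 // /r mulrC; lra.
Qed.

End the_function.

Lemma fact_le_expn n : (n`! <= n ^ n)%N.
Proof.
rewrite -ffactnn ffact_prod -[X in (_ <= _ ^ X)%N](card_ord n) -prod_nat_const.
by apply: leq_prod => i _; rewrite leq_subr.
Qed.

Section growth.
Variable R : realType.
Variable F : Cplx R -> Cplx R.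
Hypothesis sF : rapid_sum (@fcoef R) fdeg F.

Lemma circle_ub (r : R) :
  ubound [set cmod (F z) | z in [set z | cmod z = r]] (expR (r ^+ 2)).
Proof. by move=> _ [z /= <- <-]; exact: f_ub. Qed.

Lemma max_modulus_ub (r : R) : 0 <= r -> max_modulus F r <= expR (r ^+ 2).
Proof.
move=> r0; apply: ge_sup; last exact: circle_ub.
by exists (cmod (F r%:C)), r%:C => //=; exact: cmodR.
Qed.

Lemma max_modulus_lb (r : R) i : 0 <= r ->
  (r ^+ 2) ^+ half_exp i / (half_exp i)`!%:R <= max_modulus F r.
Proof.
move=> r0; apply: le_trans (f_lb i sF r0) _.
apply: ub_le_sup; first by exists (expR (r ^+ 2)); exact: circle_ub.
by exists r%:C => //=; exact: cmodR.
Qed.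

Lemma max_modulus_gt0 (r : R) : 0 <= r -> 0 < max_modulus F r.
Proof.
move=> r0; apply: lt_le_trans (max_modulus_lb 0 r0).
by rewrite /= expr0 divr1.
Qed.

Lemma ln_max_modulus_le (r : R) : 0 <= r -> ln (max_modulus F r) <= r ^+ 2.
Proof.
move=> r0; rewrite -[leRHS]expRK ler_ln ?posrE ?expR_gt0 ?max_modulus_gt0 //.
exact: max_modulus_ub.
Qed.

Lemma near_pinfty_gt (M : R) : +oo%R [set r : R | M < r].
Proof. by exists M; split; [exact: num_real | move=> x]. Qed.

Lemma limf_esup_le (h : R -> R) (b M : R) : (forall r, M < r -> h r <= b) ->
  (limf_esup (fun r => (h r)%:E) +oo%R <= b%:E)%E.
Proof.
move=> hb; rewrite limf_esupE.
apply: (@le_trans _ _ (ereal_sup [set (h r)%:E | r in [set r : R | M < r]])).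
  apply: ereal_inf_lbound; exists [set r : R | M < r] => //.
  exact: near_pinfty_gt.
by apply: ge_ereal_sup => _ [r /= Mr <-]; rewrite lee_fin hb.
Qed.

Lemma f_finite_type : order_le2_finite_type F.
Proof.
apply: (@le_lt_trans _ _ 1%:E); last exact: ltry.
apply: (@limf_esup_le _ 1 1) => r r1.
rewrite ler_pdivrMr ?exprn_gt0 ?mul1r ?ln_max_modulus_le //; lra.
Qed.

Lemma f_order_le : (growth_order F <= 2%:E)%E.
Proof.
apply: (@limf_esup_le _ 2 1) => r r1.
have lr : 0 < ln r by apply: ln_gt0.
have r0 : 0 < r by lra.
rewrite ler_pdivrMr // mulr_natl -lnXn //.
have [l0|l0] := leP (ln (max_modulus F r)) 0.
  rewrite ln0 //; apply: ln_ge0; rewrite exprn_ege1 // ltW //.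
by rewrite ler_ln ?posrE ?exprn_gt0 // ln_max_modulus_le // ltW.
Qed.

(** At r^2 = e p with p = half_exp i, the term of index i is at least
    (e p / p)^p = exp(p), since p! <= p^p.  Hence
    ln (ln M(r)) >= ln p = 2 ln r - 1. *)
Lemma f_order_ge : (2%:E <= growth_order F)%E.
Proof.
rewrite /growth_order limf_esupE; apply: le_ereal_inf_tmp => _ [V /= [M [_ MV]] <-].
apply/lee_subgt0Pr => e e0.
pose B := Num.max 1 (Num.max M (expR e^-1)).
pose i := (Num.truncn (B ^+ 2)).+1; pose p := half_exp i.
have B1 : 1 <= B by rewrite le_max lexx.
have Bp : B ^+ 2 < p%:R.
  by apply: lt_le_trans (truncnS_gt _) _; rewrite ler_nat; exact: half_exp_ge.
have e11 : 1 <= expR 1 :> R by have := expR_ge1Dx (1 : R); lra.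
pose r : R := Num.sqrt (expR 1 * p%:R).
have p0 : 0 < p%:R :> R by apply: le_lt_trans Bp; exact: sqr_ge0.
have r2 : r ^+ 2 = expR 1 * p%:R by rewrite sqr_sqrtr // mulr_ge0 // expR_ge0.
have r0 : 0 <= r by exact: sqrtr_ge0.
have Br : B < r.
  rewrite -(@ltr_pXn2r _ 2) ?nnegrE //; last by lra.
  rewrite r2; apply: lt_le_trans Bp _; rewrite ler_peMl //; exact: ltW.
have rM : M < r by apply: le_lt_trans Br; rewrite !le_max lexx !orbT.
apply: (@le_trans _ _ (ln (ln (max_modulus F r)) / ln r)%:E); last first.
  by apply: ereal_sup_ubound; exists r => //; exact: MV.
rewrite -EFinB lee_fin.
have lM : p%:R <= ln (max_modulus F r).
  rewrite -[leLHS]expRK ler_ln ?posrE ?expR_gt0 ?max_modulus_gt0 //.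
  apply: le_trans (max_modulus_lb i r0); rewrite -/p r2 exprMn.
  rewrite -expRM_natl mulr1 ler_pdivlMr ?ltr0n ?fact_gt0 //.
  rewrite ler_wpM2l ?expR_ge0 //.
  by rewrite -natrX ler_nat fact_le_expn.
have lr : e^-1 < ln r.
  rewrite -[ltLHS]expRK ltr_ln ?posrE ?expR_gt0 //; last by lra.
  by apply: le_lt_trans Br; rewrite !le_max lexx !orbT.
have ei : 0 < e^-1 by rewrite invr_gt0.
have lr0 : 0 < ln r by lra.
rewrite ler_pdivlMr //.
have lp : ln p%:R = 2 * ln r - 1 :> R.
  rewrite mulr_natl -lnXn; last by lra.
  by rewrite r2 lnM ?posrE ?expR_gt0 // expRK; ring.
apply: (@le_trans _ _ (ln p%:R)); last first.
  by rewrite ler_ln ?posrE //; lra.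
rewrite lp mulrBl lerD2l lerN2.
by rewrite -ler_pdivrMl // mulr1 ltW.
Qed.

Lemma f_order : growth_order F = 2%:E.
Proof. by apply/eqP; rewrite eq_le f_order_le f_order_ge. Qed.

End growth.

(** * Zeros of the derivatives *)

Section term_ratios.
Variables (R : realFieldType) (n : nat).

Lemma derivn_coef_ratio p h : (n <= p.*2)%N ->
  derivn_coef R n (p + h) = \prod_(t < h) coef_ratio R n (p + t) * derivn_coef R n p.
Proof.
move=> np; elim: h => [|h IH]; first by rewrite big_ord0 mul1r addn0.
rewrite addnS derivn_coefS; last by rewrite (leq_trans np) // leq_double leq_addr.
by rewrite IH big_ord_recr /= mulrCA mulrA.
Qed.

Lemma derivn_term_ratio p h (r : R) : (n <= p.*2)%N ->
  derivn_coef R n (p + h) * r ^+ ((p + h).*2 - n) =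
  \prod_(t < h) (coef_ratio R n (p + t) * r ^+ 2) * (derivn_coef R n p * r ^+ (p.*2 - n)).
Proof.
move=> np; rewrite big_split /= prodr_const card_ord derivn_coef_ratio // -exprM.
by rewrite doubleD -addnBAC // exprD mul2n; ring.
Qed.

Lemma derivn_coef_eq0 p : (p.*2 < n)%N -> derivn_coef R n p = 0.
Proof. by move=> pn; rewrite /derivn_coef ffact_small // mul0r. Qed.

End term_ratios.

Lemma radius_near (R : realFieldType) (x eta rho : R) :
  0 < x -> 0 < rho -> 0 < eta -> eta <= 1 / 2 ->
  x ^+ 2 <= (1 + eta) * rho ^+ 2 -> (1 - eta) * rho ^+ 2 <= x ^+ 2 ->
  `|rho - x| <= eta * x.
Proof.
move=> x0 r0 e0 e2 h1 h2.
rewrite ler_norml; apply/andP; split; rewrite leNgt; apply/negP => h.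
  have h' : rho <= (1 - eta) * x by lra.
  have : rho ^+ 2 <= (1 - eta) ^+ 2 * x ^+ 2.
    by rewrite -exprMn ler_pXn2r // nnegrE ?(ltW r0) // mulr_ge0 //; lra.
  move=> h3; have h4 : rho ^+ 2 * (1 + eta) <= (1 - eta) ^+ 2 * x ^+ 2 * (1 + eta).
    by rewrite ler_wpM2r //; lra.
  have : 0 < eta * (1 + eta * (1 - eta)) * x ^+ 2.
    by rewrite !mulr_gt0 ?exprn_gt0 // addr_gt0 // mulr_gt0 //; lra.
  lra.
have h' : (1 + eta) * x <= rho by lra.
have : (1 + eta) ^+ 2 * x ^+ 2 <= rho ^+ 2.
  by rewrite -exprMn ler_pXn2r // nnegrE ?(ltW r0) // mulr_ge0 //; lra.
move=> h3; have h4 : (1 + eta) ^+ 2 * x ^+ 2 * (1 - eta) <= rho ^+ 2 * (1 - eta).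
  by rewrite ler_wpM2r //; lra.
have e3 : 0 <= eta * (1 / 2 - eta) by rewrite mulr_ge0 //; lra.
have e4 : 0 <= eta * (eta * (1 / 2 - eta)) by rewrite mulr_ge0 //; lra.
have : 0 < (eta - eta * eta - eta * eta * eta) * x ^+ 2.
  by rewrite mulr_gt0 ?exprn_gt0 //; lra.
lra.
Qed.

Section zeros.
Variable R : realType.

Lemma cmod_dncoef n i : cmod (dncoef (fcoef R) fdeg n i) = derivn_coef R n (half_exp i).
Proof.
rewrite /dncoef cmodM cmod_fcoef -(rmorph_nat (real_complex R)) cmodR //.
by rewrite mulrC.
Qed.

Lemma dncoefE n i : dncoef (fcoef R) fdeg n i = (derivn_coef R n (half_exp i))%:C.
Proof.
by rewrite /dncoef /fcoef -(rmorph_nat (real_complex R)) -rmorphM mulrC.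
Qed.

(** The block estimates are the hypotheses of [zero_near] for N = 2g, where g is
    the gap of the block; tau = 1 / (8g) makes N tau equal to 1/4. *)
Lemma two_term_zero n j H (K rho : R) (u : R[i]) :
  (n <= (half_exp j).*2)%N -> 0 < K -> 200 * K <= H%:R ^+ 2 ->
  (forall i, (n <= (half_exp i).*2)%N -> (2 * H <= gap (half_exp i))%N) ->
  2 * (half_exp j.+1 + H)%:R <= n%:R + K ->
  0 < rho ->
  \prod_(t < gap (half_exp j)) (coef_ratio R n (half_exp j + t) * rho ^+ 2) = 1 ->
  u ^+ (2 * gap (half_exp j)) = -1 -> cmod u = 1 ->
  forall J, (j.+2 <= J)%N ->
  exists2 z, partial_sum (dncoef (fcoef R) fdeg n) (fun i => fdeg i - n)%N J z = 0 &
    cmod (z - rho%:C * u) <= rho / (8 * (gap (half_exp j))%:R).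
Proof.
move=> nj K0 HK gapH rangeK rho0 balanced uN u1 J jJ.
set g := gap (half_exp j).
have g0 : 0 < g%:R :> R by rewrite ltr0n gap_gt0.
have ca : cmod (rho%:C * u) = rho by rewrite cmodM u1 mulr1 cmodR // ltW.
pose tau : R := (8 * g%:R)^-1.
have tau0 : 0 < tau by rewrite invr_gt0 mulr_gt0.
have gtau : (2 * g)%:R * tau = 1 / 4.
  by rewrite /tau natrM; field; rewrite gt_eqF.
rewrite -{2}ca; apply: (@zero_near R _ _ j (2 * g) _ tau) => //.
- by rewrite dncoefE; apply: contra_neq (lt0r_neq0 (derivn_coef_gt0 R nj)) => -[].
- by apply/eqP => a0; move: ca; rewrite a0 ComplexField.Normc.normc0 => r0; rewrite -r0 ltxx in rho0.
- by rewrite /fdeg /= -/g doubleD -mul2n -(mul2n g) addnBAC // mul2n.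
- rewrite !dncoefE exprMn uN mulrN1 mulrN -rmorphXn -rmorphM; congr (- _); congr (_ %:C).
  have := balanced; rewrite big_split /= prodr_const card_ord -exprM -/g => p1.
  by rewrite /= -/g derivn_coef_ratio // mulrAC p1 mul1r.
rewrite ca => r lo hi.
have r0 : 0 < r.
  apply: lt_le_trans lo; rewrite mulr_gt0 // subr_gt0.
  rewrite invf_lt1 ?mulr_gt0 //; have : 1 <= g%:R :> R by rewrite ler1n gap_gt0.
  lra.
pose T i := derivn_coef R n (half_exp i) * r ^+ (fdeg i - n).
pose Q i := \prod_(t < gap (half_exp i)) (coef_ratio R n (half_exp i + t) * r ^+ 2).
have T0 i : 0 <= T i by rewrite mulr_ge0 ?exprn_ge0 ?(ltW r0) // divr_ge0.
have step i : (n <= (half_exp i).*2)%N -> T i.+1 = Q i * T i by exact: derivn_term_ratio.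
split=> [i ij|i ji|]; rewrite !cmod_dncoef.
- rewrite -/(T i) -/(T i.+1).
  have [ni|ni] := leqP n (half_exp i).*2; last first.
    by rewrite {1}/T derivn_coef_eq0 // mul0r divr_ge0.
  have := left_block_le nj K0 HK gapH rangeK rho0 balanced (ltW tau0) gtau lo ij ni.
  have Q0 : 0 < Q i.
    apply: prodr_gt0 => t _; rewrite mulr_gt0 ?exprn_gt0 // coef_ratio_gt0 //.
    by rewrite (leq_trans ni) // leq_double leq_addr.
  rewrite prodfV -/(Q i) (_ : 1 / 100 = 100^-1); last by rewrite mul1r.
  rewrite lef_pV2 ?posrE // => Q100.
  by rewrite step // ler_pdivlMr // mulrC ler_wpM2r.
- rewrite -/(T i) -/(T i.+1).
  have ni : (n <= (half_exp i).*2)%N by rewrite (leq_trans nj) // leq_double leq_half_exp // ltnW.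
  have := right_block_le nj K0 HK gapH rangeK rho0 balanced (ltW tau0) gtau lo hi ji.
  rewrite -/(Q i) => Qi.
  by rewrite step // mulrC ler_wpM2l // -[100^-1]mul1r.
rewrite -/(T j) -/(T j.+1).
have := mid_block_le nj rho0 balanced (ltW tau0) gtau lo hi.
by rewrite -/(Q j) => Qj; rewrite step // ler_wpM2r.
Qed.

(** A zero is found near rho u, where rho is a balanced radius close to |z0| and
    u^(2g) = -1 with u close to z0 / |z0|. *)
Lemma f_zeros F (z0 : R[i]) (e : R) : rapid_sum (fcoef R) fdeg F -> z0 != 0 -> 0 < e ->
  exists n0, forall n, (n0 <= n)%N -> exists2 z : Cplx R, cmod (z - z0) < e & F^`(n) z = 0.
Proof.
move=> sF z00 e0; set x := cmod z0.
have x0 : 0 < x.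
  rewrite lt_neqAle cmod_ge0 andbT eq_sym; apply: contra_neq z00 => /ComplexField.Normc.eq0_normc.
  by move=> ->.
pose u0 := z0 / x%:C.
have xC : x%:C != 0 by apply: contra_neq (lt0r_neq0 x0) => -[].
have z0E : z0 = x%:C * u0 by rewrite /u0 mulrCA divff ?mulr1.
have u01 : cmod u0 = 1.
  by rewrite /u0 cmodM ComplexField.Normc.normcV cmodR ?(ltW x0) // divff ?gt_eqF.
have ex0 : 0 < e / (4 * x) by rewrite divr_gt0 // mulr_gt0.
have [N1 HN1] := roots_of_m1_dense u01 ex0.
pose eta := Num.min (1 / 2) (e / (4 * x)).
have eta0 : 0 < eta by rewrite lt_min ex0 andbT.
have eta2 : eta <= 1 / 2 by rewrite ge_min lexx.
have etax : eta * x <= e / 4.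
  apply: (@le_trans _ _ (e / (4 * x) * x)); last first.
    by rewrite le_eqVlt; apply/orP; left; apply/eqP; field; rewrite gt_eqF.
  by rewrite ler_wpM2r ?(ltW x0) // ge_min lexx orbT.
have [||n0 Hn0] := @balanced_block_exists R x (eta / 8) (maxn N1 (Num.truncn (x / e)).+1) x0.
- by rewrite divr_gt0.
- lra.
exists n0 => n hn.
have [j [H [K [[nj K0 HK gapH rangeK] [gN near1]]]]] := Hn0 n hn.
have e8 : 8 * (eta / 8) = eta by field.
rewrite e8 in near1.
set g := gap (half_exp j) in gN near1.
have g0 : (0 < g)%N := gap_gt0 _.
have P0 : 0 < \prod_(t < g) coef_ratio R n (half_exp j + t).
  apply: prodr_gt0 => t _; apply: coef_ratio_gt0.
  by rewrite (leq_trans nj) // leq_double leq_addr.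
(* On the block, the factors coef_ratio * x^2 lie between 1 - eta and 1 + eta,
   and their geometric mean is x^2 / rho^2. *)
have [|rho rho0 rhoP] := @prod_root_exists R (2 * g) _ _ P0; first by rewrite muln_gt0 g0.
have balanced : \prod_(t < g) (coef_ratio R n (half_exp j + t) * rho ^+ 2) = 1.
  by rewrite big_split /= prodr_const card_ord -exprM mulrC.
have x20 : 0 < x ^+ 2 by rewrite exprn_gt0.
have r20 : 0 < rho ^+ 2 by rewrite exprn_gt0.
have s0 t : 0 < coef_ratio R n (half_exp j + t).
  by apply: coef_ratio_gt0; rewrite (leq_trans nj) // leq_double leq_addr.
have up : x ^+ 2 <= (1 + eta) * rho ^+ 2.
  have b0 : 0 <= (1 + eta) / x ^+ 2 * rho ^+ 2.
    by rewrite mulr_ge0 ?(ltW r20) // divr_ge0 ?(ltW x20) //; lra.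
  rewrite -[x ^+ 2]mul1r -ler_pdivlMr // mulrAC.
  apply: (@prod_eq1_ub _ (fun t => coef_ratio R n (half_exp j + t) * rho ^+ 2) _ g g0 b0 _ balanced) => t tg.
  rewrite mulr_ge0 ?(ltW r20) ?(ltW (s0 _)) //= ler_wpM2r ?(ltW r20) // ler_pdivlMr //.
  by have /andP[] := near1 t tg.
have lo : (1 - eta) * rho ^+ 2 <= x ^+ 2.
  have b0 : 0 <= (1 - eta) / x ^+ 2 * rho ^+ 2.
    by rewrite mulr_ge0 ?(ltW r20) // divr_ge0 ?(ltW x20) //; lra.
  rewrite -[x ^+ 2]mul1r -ler_pdivrMr // mulrAC.
  apply: (@prod_eq1_lb _ (fun t => coef_ratio R n (half_exp j + t) * rho ^+ 2) _ g g0 b0 _ balanced) => t tg.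
  rewrite ler_wpM2r ?(ltW r20) // ler_pdivrMr //.
  by have /andP[] := near1 t tg.
have rx := radius_near x0 rho0 eta0 eta2 up lo.
have [|u uN uu0] := HN1 (2 * g)%N.
  by apply: leq_trans (leq_trans (leq_maxl _ _) gN) _; rewrite mul2n -addnn leq_addr.
have u1 : cmod u = 1.
  have : `|u| ^+ (2 * g) = 1 by rewrite -normrX uN normrN1.
  move/eqP; rewrite pexpr_eq1 ?muln_gt0 ?g0 // => /eqP h.
  by apply: complexI; rewrite -normE h.
have [rn sn] := rapid_sum_derive1n (@rapid_f R) sF n.
have [|z zF za] := @rapid_sum_zero _ _ _ _ (rho%:C * u) (rho / (8 * g%:R)) rn sn.
  exists j.+2 => J jJ.
  exact: (two_term_zero nj K0 HK gapH rangeK rho0 balanced uN u1 jJ).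
exists z => //.
have gx : x / e <= g%:R.
  apply: le_trans (ltW (truncnS_gt _)) _; rewrite ler_nat.
  exact: leq_trans (leq_maxr _ _) gN.
have gR0 : 0 < g%:R :> R by rewrite ltr0n.
have r2x : rho <= 2 * x.
  have := ler_norm (rho - x); have : eta * x <= 1 / 2 * x by rewrite ler_wpM2r // ltW.
  lra.
have b1 : rho / (8 * g%:R) <= e / 4.
  rewrite ler_pdivrMr ?mulr_gt0 //.
  have : x <= e * g%:R by rewrite mulrC -ler_pdivrMr.
  lra.
have b2 : cmod (rho%:C * u - z0) <= e / 4 + e / 4.
  have -> : rho%:C * u - z0 = (rho - x)%:C * u + x%:C * (u - u0).
    by rewrite z0E rmorphB; ring.
  apply: le_trans (le_normcD _ _) _; apply: lerD; rewrite cmodM.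
    have -> : cmod (rho - x)%:C = `|rho - x| by rewrite /= expr0n addr0 sqrtr_sqr.
    by rewrite u1 mulr1; apply: le_trans rx _.
  rewrite cmodR ?(ltW x0) // mulrC -ler_pdivlMr //; apply: le_trans uu0 _.
  by rewrite le_eqVlt; apply/orP; left; apply/eqP; field; rewrite gt_eqF.
have := le_normcD (z - rho%:C * u) (rho%:C * u - z0).
rewrite addrA subrK; lra.
Qed.

End zeros.

Unset Implicit Arguments.
Set Strict Implicit.
Set Printing Implicit Defensive.

Theorem corollary4p1 (R : realType) :
  exists f : Cplx R -> Cplx R,
    [/\ transcendental_entire f,
        growth_order f = 2%:E,
        (forall z : Cplx R, cmod (f z) <= Num.sqrt 2 * expR (cmod z ^+ 2)),
        (forall U : set (Cplx R), open U -> U !=set0 ->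
           exists N : nat, forall n : nat, (N <= n)%N ->
             exists2 z : Cplx R, U z & f^`(n) z = 0)
      & boas_reddy_hypotheses f /\ ~ boas_reddy_conclusion f].
Proof.
have [f sf] := rapid_sum_exists (@rapid_f R).
exists f.
have tf : transcendental_entire f.
  split; last exact: f_not_poly sf.
  move=> z; have [G sG] := rapid_sum_exists (rapid_deriv (@rapid_f R)).
  exact: (rapid_sum_derive (@rapid_f R) sf sG z).1.
have zf (U : set (Cplx R)) : open U -> U !=set0 ->
    exists N : nat, forall n : nat, (N <= n)%N -> exists2 z : Cplx R, U z & f^`(n) z = 0.
  move=> oU [w Uw].
  have /nbhs_ballP[e' /= e'0 eU] := open_nbhs_nbhs (conj oU Uw).
  have [e e0 Ee] : exists2 e : R, 0 < e & e%:C = e'.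
    case: e' e'0 {eU} => a b; rewrite ltcE /= => /andP[/eqP -> a0].
    by exists a.
  have ballU z : cmod (z - w) < e -> U z.
    move=> zw; apply: eU; rewrite -ball_normE /= -Ee normE ltcR.
    by rewrite cmodB.
  (* Zeros are located near nonzero points only. *)
  have [z0 z00 z0w] : exists2 z0 : R[i], z0 != 0 & cmod (z0 - w) <= e / 2.
    have [w0|w0] := eqVneq w 0; last first.
      by exists w => //; rewrite subrr ComplexField.Normc.normc0; lra.
    exists (e / 2)%:C; last by rewrite w0 subr0 cmodR //; lra.
    have : e / 2 != 0 by rewrite gt_eqF // divr_gt0.
    by apply: contra_neq => -[].
  have e20 : 0 < e / 2 by rewrite divr_gt0.
  have [n0 Hn0] := f_zeros sf z00 e20.
  exists n0 => n /Hn0[z zz0 fz]; exists z => //; apply: ballU.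
  have := le_normcD (z - z0) (z0 - w); rewrite addrA subrK; lra.
split=> //.
- exact: f_order.
- move=> z; apply: le_trans (f_ub z sf) _.
  rewrite ler_peMl ?expR_ge0 // -[leLHS]sqrtr1 ler_sqrt //; lra.
split; first by split => //; exact: f_finite_type.
move=> /(_ 1 ltr01)[c [r [r1 inf]]].
have r0 : 0 < r by lra.
have rC0 : 0 < r%:C by rewrite ltcR.
have [|N HN] := zf (ball c r%:C) (ball_open _ _) _.
  by exists c; exact: ballxx.
apply: inf; apply: (@sub_finite_set _ _ `I_N); last exact: finite_II.
move=> k /= kz; rewrite ltnNge; apply/negP => /HN[z zb fz].
exact: kz zb fz.
Qed.
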